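(* Let $P_\sigma(T)$ be a Veronese $d$-polytope with induced circular composition $(\mathring T,\mathring D)$ such that $l=|\mathring D|\ge1$, let $\mathring I_1,\dots,\mathring I_l$ be the arcs into which the dividers cut $\mathring T$, numbered consecutively along the cyclic order, and let $m_j=|\mathring I_j|$. Then the number of facets of $P_\sigma(T)$ equals $$\sum_{(r_1,\dots,r_l)\in\Delta_{\frac{d-l}{2}}}\ \sum_{\substack{A,B\subset[l]\\ A,B\text{ interlacing}\\ 1\le|B|\le\lfloor l/2\rfloor}}\ \prod_{j\in A}\binom{m_j-r_j}{r_j}\prod_{j\in B}\binom{m_j-2-r_j}{r_j}\prod_{j\in[l]\setminus(A\cup B)}\binom{m_j-1-r_j}{r_j}\ +\ 2\sum_{(r_1,\dots,r_l)\in\Delta_{\frac{d-l}{2}}}\ \prod_{j\in[l]}\binom{m_j-1-r_j}{r_j}.$$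
   Context: Setting: $d\ge1$, $T=\{t_1<\dots<t_n\}\subset\mathbb R$, $n\ge d+1$, $\nu_d(t)=(1,t,\dots,t^d)$, $q_\xi(t)=\sum_{i=0}^d\xi_it^i$. A chamber $\sigma$ is the closure of a connected component of the complement in $\mathbb R^{d+1}$ of the hyperplanes $\{\xi:q_\xi(t)=0\}$, $t\in T$; $P_\sigma(T)=\mathrm{conv}\{\nu_d(t)/q_\xi(t):t\in T\}$ for $\xi$ in the interior of $\sigma$ (a $d$-polytope whose combinatorial type depends only on $\sigma$). The signed $\sigma$-decomposition partitions $T$ into maximal runs $I_1<\dots<I_{k+1}$ of consecutive elements on which $\mathrm{sgn}\,q_\xi$ is constant; $I_j=\{t_{j,1}<\dots<t_{j,n_j}\}$. Induced circular composition: $\tau$ is a bijection from $T$ onto an $n$-element set $\mathring T$ cyclically ordered so that $\tau(t_{i+1})$ comes consecutively after $\tau(t_i)$ ($i\in[n-1]$) and $\tau(t_1)$ after $\tau(t_n)$; the set of dividers $\mathring D$ consists of the pairs $\{\tau(t_{j,n_j}),\tau(t_{j+1,1})\}$, $j\in[k]$, together with $\{\tau(t_{k+1,n_{k+1}}),\tau(t_{1,1})\}$ exactly when $d$ and $k$ have different parities; so $l\equiv d\pmod2$ and $l\le d$. Each arc $\mathring I_j$ is a maximal set of cyclically consecutive elements of $\mathring T$ containing no divider. Notation: $[l]=\{1,\dots,l\}$; $\Delta_r=\{(r_1,\dots,r_l)\in\mathbb Z^l: r_j\ge0,\ \sum_j r_j=r\}$. Two sets $A=\{a_1<\dots<a_q\}$,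 $M=\{m'_1<\dots<m'_q\}\subset[l]$ are interlacing if $a_1<m'_1<a_2<m'_2<\dots<a_q<m'_q$ or $m'_1<a_1<m'_2<a_2<\dots<m'_q<a_q$. Conventions: an empty product equals $1$; $\binom{N}{K}=0$ whenever $N<0$, and $\binom{N}{0}=1$ for $N\ge0$. *)

(* Defs.v *)
From HB Require Import structures.
From mathcomp Require Import all_boot all_order all_algebra.
From mathcomp Require Import all_classical all_reals all_analysis.
Import numFieldNormedType.Exports.

Set Implicit Arguments.
Unset Strict Implicit.
Unset Printing Implicit Defensive.

Import Order.TTheory GRing.Theory Num.Theory.

Local Open Scope classical_set_scope.
Local Open Scope ring_scope.

Section Polytopes.
Variables (R : realType) (V : vectType R).
Implicit Types A P F : set V.

Definition conv_hull A : set V := smallest (@convex_set R V) A.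

Definition affine_hull A : set V :=
  [set x | exists (m : nat) (a : 'I_m -> R) (y : 'I_m -> V),
     [/\ forall i, A (y i), \sum_i a i = 1 & x = \sum_i a i *: y i]].

Definition has_dim A (k : nat) : Prop :=
  exists (p : V) (U : {vspace V}),
    affine_hull A = [set p + u | u in [set` U]] /\ \dim U = k.

Definition face P F : Prop :=
  exists (a : {linear V -> R^o}) (b : R),
    (forall x, P x -> a x <= b) /\ F = P `&` [set x | a x = b].

Definition facet P F : Prop :=
  face P F /\ exists k : nat, has_dim P k.+1 /\ has_dim F k.

Definition facets P : set (set V) := [set F | facet P F].

End Polytopes.

(* The set T is given by its increasing enumeration t : 'I_n -> R, and a subset
   of T by the corresponding set of indices. *)
Section Veronese.
Variables (R : realType) (d n : nat).
Implicit Types (t : 'I_n -> R) (xi : 'rV[R]_d.+1).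

Definition veronese (x : R) : 'rV[R]_d.+1 := \row_(i < d.+1) x ^+ i.

Definition qpoly xi (x : R) : R := \sum_(i < d.+1) xi 0 i * x ^+ i.

Definition hyperplane_complement t : set 'rV[R]_d.+1 :=
  [set xi | forall i, qpoly xi (t i) != 0].

Definition chamber t (sigma : set 'rV[R]_d.+1) : Prop :=
  exists2 xi, hyperplane_complement t xi &
    sigma = closure (connected_component (hyperplane_complement t) xi).

Definition veronese_polytope t xi : set 'rV[R]_d.+1 :=
  conv_hull (range (fun i => (qpoly xi (t i))^-1 *: veronese (t i))).

Definition sign_run t xi (I : {set 'I_n}) : bool :=
  [forall i in I, forall j in I,
     (Num.sg (qpoly xi (t i)) == Num.sg (qpoly xi (t j)))
     && [forall h : 'I_n, (i <= h <= j)%N ==> (h \in I)]].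

Definition signed_decomposition t xi : {set {set 'I_n}} :=
  [set I | maxset (sign_run t xi) I]%SET.

Definition sign_changes t xi : nat := #|signed_decomposition t xi|.-1.

Definition divider_at t xi (p : 'I_n * 'I_n) : bool :=
  [exists I in signed_decomposition t xi, exists J in signed_decomposition t xi,
     [&& I != J, p.1 \in I, p.2 \in J & p.2 == p.1.+1 :> nat]]
  || [&& p.1 == n.-1 :> nat, p.2 == 0%N :> nat
       & odd d != odd (sign_changes t xi)].

(* A divider is stored as the ordered pair (x, successor of x): for n = 2 the
   unordered pair would not tell the two gaps of the cyclic order apart. *)
Definition dividers (C : finType) (tau : 'I_n -> C) t xi : {set C * C} :=
  [set (tau p.1, tau p.2) | p : 'I_n * 'I_n & divider_at t xi p]%SET.

End Veronese.

Section Cyclic.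
Variable C : finType.
Implicit Types (next : C -> C) (D : {set C * C}).

Definition cyclic_bijection n next (tau : 'I_n -> C) : Prop :=
  bijective tau /\ forall i, next (tau i) = tau (ordS i).

(* Containing no divider means that no two successive elements of the run form
   a divider; when there is a single divider, its two members are the last and
   the first element of the unique arc, which is all of C. *)
Definition divider_free_run next D (A : {set C}) : bool :=
  [exists x : C, exists m : 'I_#|C|.+1,
     (A == [set y in traject next x m]%SET)
     && sorted (fun y z => (y, z) \notin D) (traject next x m)].

Definition arcs next D : {set {set C}} :=
  [set A | maxset (divider_free_run next D) A]%SET.

Definition arc_numbering next D (l : nat) (I : 'I_l -> {set C}) : Prop :=
  [/\ injective I,
      arcs next D = [set I j | j : 'I_l]%SET
    & forall j, exists2 p, p \in D & p.1 \in I j /\ p.2 \in I (ordS j)].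

End Cyclic.

Definition interleave (a b : seq nat) : seq nat :=
  flatten [seq [:: p.1; p.2] | p <- zip a b].

Definition interlacing (l : nat) (A B : {set 'I_l}) : bool :=
  let a := [seq val i | i <- enum A] in
  let b := [seq val i | i <- enum B] in
  (#|A| == #|B|)
  && (sorted ltn (interleave a b) || sorted ltn (interleave b a)).

(* Not ssrnat's truncated subtraction: binz (-1) 0 is 0, not 1. *)
Definition binz (N : int) (K : nat) : nat :=
  if N is Posz p then 'C(p, K) else 0%N.

(* The compositions in Delta_s are the r with sum s; r j <= s is automatic. *)
Definition facet_formula (l s : nat) (m : 'I_l -> nat) : nat :=
  (\sum_(r : {ffun 'I_l -> 'I_s.+1} | \sum_(j < l) r j == s)
     \sum_(A : {set 'I_l})
       \sum_(B : {set 'I_l} | interlacing A B && (1 <= #|B| <= l./2))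
         (\prod_(j in A) binz ((m j)%:Z - (r j)%:Z) (r j)
          * \prod_(j in B) binz ((m j)%:Z - 2 - (r j)%:Z) (r j)
          * \prod_(j in ~: (A :|: B)) binz ((m j)%:Z - 1 - (r j)%:Z) (r j))
   + 2 * \sum_(r : {ffun 'I_l -> 'I_s.+1} | \sum_(j < l) r j == s)
           \prod_(j < l) binz ((m j)%:Z - 1 - (r j)%:Z) (r j))%N.

(* Main.v *)
Require Import Defs.
From HB Require Import structures.
From mathcomp Require Import all_boot all_order all_algebra.
From mathcomp Require Import all_classical all_reals all_analysis.
From mathcomp Require Import zify ring.
Import numFieldNormedType.Exports.
Import Order.TTheory GRing.Theory Num.Theory.

Set Implicit Arguments.
Unset Strict Implicit.
Unset Printing Implicit Defensive.

Local Open Scope ring_scope.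

(**
Facets correspond to the [d]-sets [S] of nodes for which
[prod_(s in S) (t_i - t_s) * q(t_i)] has a constant sign off [S], a Gale
evenness condition twisted by the signs of [q].  Walking around the circle, this
says that a parity [w] can be attached to the nodes so that
[w (i + 1) = w i + [i is followed by a divider] + [i in S]] modulo 2 and [w i = 0]
off [S].  Since [d < n], such a [w] is unique; conversely [w] determines [S], and
the only constraint on [w] is local: [w i] forces [w (i + 1)] to be the divider
indicator.  Moreover [#|S| = l + 2 * o], where [o] is the number of steps
[0 -> 1] without a divider.  So the facets are counted by the coefficient of
[X^((d - l) / 2)] in the trace of a cyclic product of two 2 x 2 transfer
matrices, one for dividers and one for the other gaps.  Grouping the factors arc
by arc gives matrices whose entries are the Fibonacci-like polynomials with
coefficients [binom(m - r, r)], [binom(m - 1 - r, r)], [binom(m - 2 - r, r)].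
Expanding the trace over the parities at the starts of the arcs, the arcs where
the parity goes up form [A], those where it goes down form [B]; the two constant
sequences give the second sum.  Finally [l <= d] because [q] has at most [d]
roots.
*)

(** * Coefficients and traces of products *)

(** Truncating every factor above degree [s] leaves this coefficient unchanged, and the truncated
    sums share a finite index type, so that distributivity applies. *)
Lemma coef_prod_ffun (R : comNzRingType) (l s : nat) (p : 'I_l -> {poly R}) :
  (\prod_j p j)`_s =
  \sum_(r : {ffun 'I_l -> 'I_s.+1} | (\sum_j r j)%N == s) \prod_j (p j)`_(r j).
Proof.
have trunc (I : Type) (h : seq I) (f : I -> {poly R}) i : (i < s.+1)%N ->
    (\prod_(j <- h) f j)`_i =
    (\prod_(j <- h) (\sum_(k < s.+1) (f j)`_k *: 'X^k))`_i.
  elim: h i => [|x h IH] i si; first by rewrite !big_nil.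
  rewrite !big_cons !coefM; apply: eq_bigr => -[j /= ji] _.
  rewrite IH; last by lia.
  congr (_ * _); rewrite coef_sum (bigD1 (Ordinal (leq_trans ji si))) //=.
  rewrite coefZ coefXn eqxx mulr1 big1 ?addr0 // => k kj.
  rewrite coefZ coefXn; case: eqP => [jk|]; last by rewrite mulr0.
  by case/eqP: kj; apply: val_inj.
rewrite trunc // bigA_distr_bigA coef_sum [RHS]big_mkcond /=; apply: eq_bigr => r _.
rewrite scaler_prod.
rewrite -expr_sum coefZ coefXn eq_sym; case: eqP => _; by rewrite ?mulr1 ?mulr0.
Qed.

Definition state (a : bool) : 'I_2 := if a then ord_max else ord0.

Lemma sum_state (V : nmodType) (F : 'I_2 -> V) :
  \sum_i F i = \sum_a F (state a).
Proof. by rewrite big_bool /= !big_ord_recl big_ord0 addr0 addrC; congr (F _ + _); apply: val_inj. Qed.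

Definition extend (k : nat) (p : {ffun 'I_k -> bool} * bool) :
  {ffun 'I_k.+1 -> bool} := [ffun i => oapp p.1 p.2 (unlift ord_max i)].

Lemma sum_extend (V : nmodType) (k : nat) (F : {ffun 'I_k.+1 -> bool} -> V) :
  \sum_w F w = \sum_w \sum_b F (extend (w, b)).
Proof.
rewrite pair_big /= (reindex (@extend k)) /=; last first.
  exists (fun w => ([ffun i => w (lift ord_max i)], w ord_max)) => [[w b] _|w _].
    rewrite /extend ffunE unlift_none /=; congr (_, _).
    by apply/ffunP => i; rewrite !ffunE liftK.
  apply/ffunP => i; rewrite ffunE /=.
  by case: unliftP => [j|] ->; rewrite /= ?ffunE.
by apply: eq_bigr => -[].
Qed.

Section TransferMatrix.
Variable R : comNzRingType.

(** By induction on the length, the last step being split off with [sum_extend]. The factors are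
    indexed by [nat] so that shortening the product does not change their type. *)
Lemma prod_mx_walk (k : nat) (M : nat -> 'M[R]_2) (a b : bool) :
  (\prod_(0 <= i < k) M i) (state a) (state b) =
  \sum_(w : {ffun 'I_k.+1 -> bool} | (w ord0 == a) && (w ord_max == b))
    \prod_(i < k) M i (state (w (inord i))) (state (w (inord i.+1))).
Proof.
elim: k b => [|k IH] b.
  rewrite big_nil big_mkcond /= sum_extend exchange_big /= big_bool /=.
  have W (c : bool) : \sum_(w : {ffun 'I_0 -> bool})
     (if (extend (w, c) ord0 == a) && (extend (w, c) ord_max == b)
      then \prod_(i < 0) M i (state (extend (w, c) (inord i))) (state (extend (w, c) (inord i.+1)))
      else 0) = ((c == a) && (c == b))%:R.
    under eq_bigr => w _.
      rewrite big_ord0 !ffunE (_ : ord0 = ord_max); last exact: val_inj.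
      rewrite unlift_none /=. over.
    rewrite sumr_const card_ffun card_ord card_bool expn0 mulr1n.
    by case: ifP.
  by rewrite !W mxE; case: a {W}; case: b; rewrite /= ?addr0 ?add0r.
rewrite big_nat_recr //= mxE sum_state [RHS]big_mkcond [RHS]sum_extend /=.
under eq_bigr => c _ do rewrite IH big_distrl big_mkcond /=.
have ext0 w c : extend (w, c) ord0 = w ord0 :> bool.
  rewrite ffunE (_ : ord0 = lift ord_max ord0) ?liftK //; exact: val_inj.
have extm (w : {ffun 'I_k.+1 -> bool}) c : extend (w, c) ord_max = c :> bool.
  by rewrite ffunE unlift_none.
have exti (w : {ffun 'I_k.+1 -> bool}) c i : (i <= k)%N -> extend (w, c) (inord i) = w (inord i) :> bool.
  move=> ik; rewrite ffunE (_ : inord i = lift ord_max (inord i)) ?liftK //.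
  by apply: val_inj; rewrite /= /bump !inordK; lia.
rewrite exchange_big /=; apply: eq_bigr => w _.
under [RHS]eq_bigr => c _ do rewrite ext0 extm.
rewrite (bigD1 (w ord_max)) //= eqxx andbT [X in _ + X]big1 ?addr0; last first.
  by move=> c cw; rewrite [_ == c]eq_sym (negPf cw) andbF.
rewrite (bigD1 b) //= eqxx andbT [X in _ + X]big1 ?addr0; last first.
  by move=> c cw; rewrite (negPf cw) andbF.
case: ifP => // _; rewrite big_ord_recr /=; congr (_ * _).
  by apply: eq_bigr => i _; have := ltn_ord i => ik; rewrite !exti //; lia.
rewrite exti // (_ : inord k = ord_max); last by apply: val_inj; rewrite /= inordK.
by rewrite (_ : inord k.+1 = ord_max) ?extm //; apply: val_inj; rewrite /= inordK.
Qed.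

(** The last factor leads from the end of an open walk back to its start; this is where [ordS] wraps
    around. *)
Lemma trace_prod_walk (n : nat) (M : 'I_n.+1 -> 'M[R]_2) :
  \tr (\prod_i M i) =
  \sum_(w : {ffun 'I_n.+1 -> bool})
    \prod_i M i (state (w i)) (state (w (ordS i))).
Proof.
have -> : \prod_i M i = (\prod_(0 <= i < n) M (inord i)) *m M ord_max.
  rewrite big_ord_recr big_mkord /=; congr (_ *m _); apply: eq_bigr => i _; congr M.
  by apply: val_inj; rewrite /= inordK //; have := ltn_ord i; lia.
rewrite /mxtrace sum_state.
transitivity (\sum_(a : bool) \sum_(w : {ffun 'I_n.+1 -> bool}) \sum_(b : bool)
    if (w ord0 == a) && (w ord_max == b) then
      (\prod_(i < n) M (inord i) (state (w (inord i))) (state (w (inord i.+1))))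
      * M ord_max (state b) (state a) else 0).
  apply: eq_bigr => a _; rewrite mxE sum_state exchange_big; apply: eq_bigr => b _.
  by rewrite prod_mx_walk big_distrl big_mkcond /=.
rewrite exchange_big /=; apply: eq_bigr => w _.
rewrite (bigD1 (w ord0)) //= (bigD1 (w ord_max)) //= !eqxx /= [X in _ + X + _]big1 ?addr0; last first.
  by move=> c cw; rewrite [_ == c]eq_sym (negPf cw).
rewrite [X in _ + X]big1 ?addr0; last first.
  by move=> c cw; rewrite big1 // => b _; rewrite [_ == c]eq_sym (negPf cw).
rewrite [RHS]big_ord_recr /=; congr (_ * _).
  apply: eq_bigr => i _; rewrite (_ : inord i = widen_ord (leqnSn n) i); last first.
    by apply: val_inj; rewrite /= inordK //; have := ltn_ord i; lia.
  congr (M _ _ (state (w _))); apply: val_inj; have := ltn_ord i => ni.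
  by rewrite /= inordK // modn_small.
by congr (M _ _ (state (w _))); apply: val_inj; rewrite /= modnn.
Qed.

(** Lets the product start at the first element of an arc, which need not be the first node. *)
Lemma trace_prod_rot (I : Type) (n k : nat) (M : I -> 'M[R]_n.+1) (s : seq I) :
  \tr (\prod_(i <- rot k s) M i) = \tr (\prod_(i <- s) M i).
Proof.
by rewrite /rot big_cat -[in RHS](cat_take_drop k s) big_cat /= mxtrace_mulC.
Qed.

End TransferMatrix.

(** * Transfer matrices of gaps and arcs *)

Section ArcPolynomials.

(* Step of a walk through a gap: state [true] must be followed by [dv], and ['X]
   marks the steps from [false] to [true] through a gap without divider. *)
Definition step_mx (dv : bool) : 'M[{poly int}]_2 :=
  \matrix_(a, b) (((a == ord_max) ==> ((b == ord_max) == dv))%:R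
     * 'X^(~~ dv && (a != ord_max) && (b == ord_max))).

Lemma stateE a : (state a == ord_max) = a.
Proof. by case: a. Qed.

Lemma step_mxE dv a b : step_mx dv (state a) (state b) =
  (a ==> (b == dv))%:R * 'X^(~~ dv && ~~ a && b).
Proof. by rewrite mxE !stateE. Qed.

(** Fibonacci polynomials. The value 0 at index 0 matches the convention that a binomial with top -1
    vanishes; it occurs for an arc with a single element. *)
Fixpoint arc_poly (k : nat) : {poly int} :=
  if k is k1.+1 then
    if k1 is k2.+1 then arc_poly k1 + 'X * arc_poly k2 else 1
  else 0.

Lemma arc_polySS k : arc_poly k.+2 = arc_poly k.+1 + 'X * arc_poly k.
Proof. by []. Qed.

Lemma binz_lt0 N K : N < 0 -> binz N K = 0%N.
Proof. by case: N. Qed.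

(** The recurrence [arc_polySS] read on coefficients is Pascal's rule; it survives at the boundary
    because [binz] vanishes on negative tops. *)
Lemma coef_arc_poly k r : (arc_poly k)`_r = binz (k%:Z - 1 - r%:Z) r.
Proof.
have [n] := ubnP k; elim: n k r => // n IH [|[|k]] r kn.
- by rewrite coef0 binz_lt0 //; lia.
- by rewrite coef1; case: r => [|r]; last by rewrite binz_lt0 //; lia.
rewrite arc_polySS coefD coefXM !IH; try lia.
case: r => [|r].
  have -> : k.+1%:Z - 1 - 0%:Z = k%:Z by lia.
  have -> : k.+2%:Z - 1 - 0%:Z = k.+1%:Z by lia.
  by rewrite eqxx addr0 /binz !bin0.
rewrite [_ == 0%N]/=.
have -> : k.+2%:Z - 1 - r.+1%:Z = k%:Z - r%:Z by lia.
have -> : k.+1%:Z - 1 - r.+1%:Z = k%:Z - r%:Z - 1 by lia.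
have -> : k%:Z - 1 - r%:Z = k%:Z - r%:Z - 1 by lia.
have [rk|kr] := leqP r k; last first.
  by rewrite !binz_lt0 //; lia.
rewrite (subzn rk); case: (k - r)%N => [|p].
  by rewrite (binz_lt0 _ (_ : _ - 1 < 0)) //= (binz_lt0 _ (_ : _ - 1 < 0)).
have -> : p.+1%:Z - 1 = p by lia.
by rewrite /= binS PoszD.
Qed.

(** An arc with m = k + 1 elements has [k] inner gaps and then a divider. The binomial tops are m -
    1 - r when the parity is kept, m - 2 - r when it goes down and m - r when it goes up. *)
Lemma arc_mxE k a b : (step_mx false ^+ k * step_mx true) (state a) (state b) =
  if a == b then arc_poly k.+1 else if a then arc_poly k else arc_poly k.+2.
Proof.
elim: k a => [|k IH] a.
  by rewrite expr0 mul1r step_mxE; case: a; case: b => /=; rewrite ?expr0 ?mulr1 ?mulr0 ?addr0.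
rewrite exprS -mulrA mxE sum_state big_bool !IH !step_mxE.
clear IH; case: a; case: b => /=; rewrite ?expr0 ?expr1 ?mul1r ?mul0r ?mulr1 ?add0r //=; ring.
Qed.

End ArcPolynomials.

(** * Interlacing sets and alternating sequences *)

Section Interleave.
Implicit Types (a b : seq nat).

(** Alternation starting with [a] means that below every threshold [a] is level with [b] or one
    ahead. This form can be compared with the partial counts of ascents and descents. *)
Lemma sorted_interleaveP a b : size a = size b -> sorted ltn a -> sorted ltn b ->
  reflect ((forall j, (count (fun i => i < j) b <= count (fun i => i < j) a
                       <= (count (fun i => i < j) b).+1))%N
           /\ (forall i, i \in a -> i \notin b))
          (sorted ltn (interleave a b)).
Proof.
elim: a b => [|x a IH] [|y b] //= sz; first by move=> _ _; apply: ReflectT; split.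
case: sz => sz sa sb.
have sa' := path_sorted sa; have sb' := path_sorted sb.
have lt0 z s j : (j <= z)%N -> path ltn z s -> count (fun i => (i < j)%N) s = 0%N.
  move=> jz /(order_path_min ltn_trans)/allP zs.
  apply/eqP; rewrite eqn0Ngt -has_count; apply/hasPn => i /zs /=; lia.
rewrite /interleave /= -/(interleave a b).
have mem_int i a' b' : size a' = size b' -> (i \in interleave a' b') = (i \in a') || (i \in b').
  elim: a' b' => [|u a' IH'] [|v b'] //= [] /IH' e.
  by rewrite /interleave /= !inE -/(interleave a' b') e; case: (i == u); case: (i == v); rewrite /= ?orbT.
apply: (iffP idP) => /=.
  case/andP=> xy yp; have sI := path_sorted yp.
  have yI := order_path_min ltn_trans yp.
  have [IHc IHd] := IH b sz sa' sb' sI.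
  have ya : all (ltn y) a.
    by apply/allP => i ia; apply: (allP yI); rewrite mem_int // ia.
  split.
    move=> j; have [jy|yj] := leqP j y.
      rewrite [count _ b](lt0 y) // (_ : count _ a = 0%N); first by case: (x < j)%N.
      apply/eqP; rewrite eqn0Ngt -has_count; apply/hasPn => i /(allP ya) /=; lia.
    by have := IHc j; rewrite (ltn_trans xy yj) /=; lia.
  move=> i; rewrite !inE => /orP[/eqP ->|ia].
    apply/norP; split; first by rewrite neq_ltn xy.
    apply/negP => xb; have := allP (order_path_min ltn_trans sb) _ xb; rewrite /=; lia.
  rewrite negb_or IHd // andbT.
  by have := allP ya _ ia; rewrite /= neq_ltn orbC => ->.
case=> cnt dis.
(* Otherwise [b] would be ahead at threshold [y.+1]. *)
have xy : (x < y)%N.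
  have := dis x; rewrite !inE eqxx => /(_ isT) /norP[nxy _].
  have := cnt y.+1; rewrite ltnSn /=; have [//|yx] := ltnP x y.
  by rewrite (lt0 x a y.+1) //; lia.
rewrite xy /=.
(* If the second element [z] of the first list came before [y], that list would be two ahead at
   threshold [z.+1]. *)
have ya : all (ltn y) a.
  case: a {IH sz sa' mem_int} sa dis cnt => [|z a] //= sa dis cnt.
  case/andP: sa => xz za.
  have yz : (y < z)%N.
    have := dis z; rewrite !inE eqxx orbT => /(_ isT) /norP[nzy _].
    have := cnt z.+1; rewrite ltnSn (ltn_trans xz (ltnSn z)) /=.
    have [//|zy] := ltnP y z.
    by rewrite (lt0 y b z.+1) //; lia.
  rewrite yz /=; apply: sub_all (order_path_min ltn_trans za) => i /=; lia.
have yb := order_path_min ltn_trans sb.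
rewrite path_min_sorted; last first.
  by apply/allP => i; rewrite mem_int // => /orP[/(allP ya)|/(allP yb)].
apply/IH => //; split.
  move=> j; have [jy|yj] := leqP j y.
    rewrite [count _ b](lt0 y) // (_ : count _ a = 0%N) //.
    apply/eqP; rewrite eqn0Ngt -has_count; apply/hasPn => i /(allP ya) /=; lia.
  by have := cnt j; rewrite yj (ltn_trans xy yj) /=; lia.
by move=> i ia; have := dis i; rewrite !inE ia orbT => /(_ isT) /norP[].
Qed.

End Interleave.

Section Alternation.
Variable l : nat.
Implicit Types (A B : {set 'I_l.+1}) (f : {ffun 'I_l.+1 -> bool}).

Definition cnt_below A (j : nat) : nat := \sum_(i in A) (i < j)%N.

Lemma cnt_below0 A : cnt_below A 0 = 0%N.
Proof. by rewrite /cnt_below big1. Qed.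

Lemma cnt_below_top A : cnt_below A l.+1 = #|A|.
Proof. by rewrite -sum1_card; apply: eq_bigr => i _; rewrite ltn_ord. Qed.

Lemma cnt_belowS A (j : 'I_l.+1) : cnt_below A j.+1 = (cnt_below A j + (j \in A))%N.
Proof.
rewrite /cnt_below; case: (boolP (j \in A)) => jA; last first.
  rewrite addn0; apply: eq_bigr => i iA; rewrite ltnS leq_eqVlt.
  by have -> : (i == j :> nat) = false by apply/negP => /eqP/val_inj ij; rewrite -ij iA in jA.
rewrite !(bigD1 j jA) /= ltnSn ltnn add0n addnC -[nat_of_bool true]/1%N; congr addn.
apply: eq_bigr => i /andP[_ ij]; rewrite ltnS leq_eqVlt.
by have -> : (i == j :> nat) = false by apply/negP => /eqP/val_inj e; rewrite e eqxx in ij.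
Qed.

Lemma count_enum_ord A j : count (fun i => (i < j)%N) [seq val i | i <- enum A] = cnt_below A j.
Proof. by rewrite count_map -sum1_count big_mkcond /= big_enum. Qed.

Lemma sorted_enum_ord A : sorted ltn [seq val i | i <- enum A].
Proof.
apply: (subseq_sorted ltn_trans _ (iota_ltn_sorted 0 l.+1)).
by rewrite -val_enum_ord; apply: map_subseq; rewrite enumT; apply: filter_subseq.
Qed.

Lemma interlacingP A B :
  reflect [/\ #|A| = #|B|, (forall i, i \in A -> i \notin B) &
    (forall j, cnt_below B j <= cnt_below A j <= (cnt_below B j).+1)%N \/
    (forall j, cnt_below A j <= cnt_below B j <= (cnt_below A j).+1)%N]
   (interlacing A B).
Proof.
have szE (C : {set 'I_l.+1}) : size [seq val i | i <- enum C] = #|C| by rewrite size_map -cardE.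
have memE (C : {set 'I_l.+1}) (i : 'I_l.+1) : (val i \in [seq val i | i <- enum C]) = (i \in C).
  by rewrite mem_map ?mem_enum //; exact: val_inj.
have dis (C C' : {set 'I_l.+1}) : (forall i, i \in C -> i \notin C') <->
    (forall i, i \in [seq val i | i <- enum C] -> i \notin [seq val i | i <- enum C']).
  split=> [H i /mapP[k kC ->]|H i]; last by rewrite -memE => /H; rewrite memE.
  by rewrite memE H // -(mem_enum C).
have SP (C C' : {set 'I_l.+1}) (eq : #|C| = #|C'|) :=
  @sorted_interleaveP [seq val i | i <- enum C] [seq val i | i <- enum C']
   (etrans (szE C) (etrans eq (esym (szE C')))) (sorted_enum_ord C) (sorted_enum_ord C').
apply: (iffP idP) => [/andP[/eqP cAB /orP[/SP|/SP]]|[cAB dAB H]].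
- move=> /(_ cAB)[H /dis dAB]; split=> //; left => j.
  by have := H j; rewrite !count_enum_ord.
- move=> /(_ (esym cAB))[H /dis dAB]; split=> //; last first.
    by right => j; have := H j; rewrite !count_enum_ord.
  by move=> i iA; apply/negP => /dAB; rewrite iA.
rewrite /interlacing cAB eqxx /=; apply/orP; case: H => H; [left|right].
  by apply/SP => //; split; [move=> j; rewrite !count_enum_ord|apply/dis].
apply/SP => //; split; first by move=> j; rewrite !count_enum_ord.
by apply/dis => i iB; apply/negP => /dAB; rewrite iB.
Qed.

Definition ascents f : {set 'I_l.+1} := [set j | ~~ f j && f (ordS j)]%SET.
Definition descents f : {set 'I_l.+1} := [set j | f j && ~~ f (ordS j)]%SET.

(** The difference of the two counts telescopes. The case [j = l.+1] is included, where the index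
    wraps around to 0. *)
Lemma cnt_ascents f j : (j <= l.+1)%N ->
  (cnt_below (ascents f) j + f ord0
   = cnt_below (descents f) j + f (inord (j %% l.+1)))%N.
Proof.
elim: j => [|j IH] jl.
  by rewrite !cnt_below0 mod0n (_ : inord 0 = ord0) //; apply: val_inj; rewrite /= inordK.
have {IH} := IH (ltnW jl).
have -> : (j.+1 = (inord j : 'I_l.+1).+1)%N by rewrite inordK.
rewrite !cnt_belowS (modn_small jl) !inE.
rewrite (_ : inord (_ %% _) = ordS (inord j)); last first.
  by apply: val_inj; rewrite /= !inordK // ltn_mod.
rewrite !inordK //; case: (f _); case: (f (ordS _)) => /=; lia.
Qed.

Lemma cnt_ascents_ord f (j : 'I_l.+1) :
  (cnt_below (ascents f) j + f ord0 = cnt_below (descents f) j + f j)%N.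
Proof.
rewrite cnt_ascents ?(ltnW (ltn_ord j)) // modn_small //; congr (_ + f _)%N.
by apply: val_inj; rewrite /= inordK.
Qed.

Lemma card_ascents f : #|ascents f| = #|descents f|.
Proof.
have := cnt_ascents f (leqnn l.+1); rewrite !cnt_below_top modnn.
rewrite (_ : inord 0 = ord0); first by move/addIn.
by apply: val_inj; rewrite /= inordK.
Qed.

Lemma ascents_interlacing f : interlacing (ascents f) (descents f).
Proof.
apply/interlacingP; split; first exact: card_ascents.
  by move=> i; rewrite !inE => /andP[/negPf ->].
have H j : (l.+1 <= j)%N -> cnt_below (ascents f) j = cnt_below (descents f) j.
  move=> lj; have E C : cnt_below C j = #|C|.
    rewrite -cnt_below_top; apply: eq_bigr => i _; rewrite ltn_ord.
    by rewrite (leq_trans (ltn_ord i) lj).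
  by rewrite !E card_ascents.
have := cnt_ascents_ord f.
case: (f ord0) => c; [right|left] => j.
  have [lj|jl] := leqP l.+1 j; first by rewrite H //; lia.
  by have /= := c (Ordinal jl); case: (f _); lia.
have [lj|jl] := leqP l.+1 j; first by rewrite H //; lia.
by have /= := c (Ordinal jl); case: (f _); lia.
Qed.

(** Recovers a nonconstant [f] from its ascents and descents: [f ord0] is true exactly when the
    descents are ahead somewhere, and unequal counts mark the places where [f] differs from
    [f ord0]. *)
Definition alternation A B : {ffun 'I_l.+1 -> bool} :=
  [ffun j : 'I_l.+1 => [exists i : 'I_l.+2, (cnt_below A i < cnt_below B i)%N]
    (+) (cnt_below A j != cnt_below B j)].

Lemma ascentsK f : (0 < #|descents f|)%N -> alternation (ascents f) (descents f) = f.
Proof.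
rewrite card_gt0 => /set0Pn[i]; rewrite inE => /andP[fi nfi].
have c := cnt_ascents_ord f.
apply/ffunP => j; rewrite ffunE.
have -> : [exists i : 'I_l.+2, (cnt_below (ascents f) i < cnt_below (descents f) i)%N] = f ord0.
  apply/idP/idP => [/existsP[k]|f0].
    have := ltn_ord k; rewrite ltnS => kl.
    have := cnt_ascents f kl; case: (f ord0) => //; lia.
  (* Right after the descent [i] the value is false, so with [f ord0] true the descents are one
     ahead there. *)
  apply/existsP; exists (widen_ord (leqnSn _) (ordS i)); have /= := c (ordS i).
  by rewrite f0 (negPf nfi); lia.
by have := c j; case: (f ord0); case: (f j) => /=; lia.
Qed.

Lemma alternationK A B : (0 < #|B|)%N -> interlacing A B ->
  (ascents (alternation A B), descents (alternation A B)) = (A, B).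
Proof.
move=> B0 /interlacingP[cAB dAB H].
pose u j := cnt_below A j != cnt_below B j.
(* At the wrap-around the counts agree, as [A] and [B] have equal size. *)
have uS (j : 'I_l.+1) : u (ordS j) = u j.+1.
  rewrite /u /=; have := ltn_ord j; rewrite leq_eqVlt => /orP[/eqP [jl]|jl].
    by rewrite jl modnn !cnt_below0 !cnt_below_top cAB !eqxx.
  by rewrite modn_small.
case: H => H.
  have ex : [exists i : 'I_l.+2, (cnt_below A i < cnt_below B i)%N] = false.
    apply: negbTE; apply/negP => /existsP[i]; have := H i; lia.
  have al j : alternation A B j = u j by rewrite ffunE ex.
  congr (_, _); apply/setP => j; rewrite !inE !al uS /u !cnt_belowS;
  have := dAB j; have := H j; have := H j.+1; rewrite !cnt_belowS;
  case: (j \in A); case: (j \in B) => /= h1 h2 h3; first [by have := h3 isT | lia].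
have ex : [exists i : 'I_l.+2, (cnt_below A i < cnt_below B i)%N].
  (* Here [A] is never ahead, so [B] is strictly ahead just after any of its own elements. *)
  apply/existsP; move: B0; rewrite card_gt0 => /set0Pn[b bB].
  exists (lift ord0 b); rewrite /= /bump /= add1n.
  have := dAB b; have := H b; rewrite !cnt_belowS bB.
  by case: (b \in A) => [_ /(_ isT)|]//=; lia.
have al j : alternation A B j = ~~ u j by rewrite ffunE ex.
congr (_, _); apply/setP => j; rewrite !inE !al uS /u !cnt_belowS;
  have := dAB j; have := H j; have := H j.+1; rewrite !cnt_belowS;
  case: (j \in A); case: (j \in B) => /= h1 h2 h3; first [by have := h3 isT | lia].
Qed.

Lemma descents0_constant f : #|descents f| = 0%N -> f = [ffun=> f ord0].
Proof.
move=> d0; apply/ffunP => j; rewrite ffunE; have := cnt_ascents_ord f j.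
have a0 : #|ascents f| = 0%N by rewrite card_ascents.
rewrite /cnt_below !big1 ?add0n; first by case: (f ord0); case: (f j).
  by move=> i; rewrite (cards0_eq d0) inE.
by move=> i; rewrite (cards0_eq a0) inE.
Qed.

(** Functions with a descent correspond to interlacing pairs with [B] nonempty; the two constant
    functions give the last term. *)
Lemma sum_alternation (gA gB g0 : 'I_l.+1 -> nat) :
  (\sum_(f : {ffun 'I_l.+1 -> bool}) \prod_j
     (if f j == f (ordS j) then g0 j else if f j then gB j else gA j) =
   \sum_(A : {set 'I_l.+1})
     \sum_(B : {set 'I_l.+1} | interlacing A B && (1 <= #|B| <= l.+1./2))
       \prod_(j in A) gA j * \prod_(j in B) gB j * \prod_(j in ~: (A :|: B)) g0 j
   + 2 * \prod_j g0 j)%N.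
Proof.
rewrite (bigID (fun f => 0 < #|descents f|)%N) /=; congr (_ + _)%N.
  rewrite pair_big_dep /= (reindex_onto (fun f => (ascents f, descents f))
     (fun p => alternation p.1 p.2)) /=; last first.
    by move=> [A B] /= /andP[iAB /andP[B0 _]]; exact: alternationK.
  apply: eq_big => [f|f d0].
    rewrite ascents_interlacing /=; have [d0|] := ltnP 0 #|descents f|; last by [].
    (* The upper bound on the size of [B] is automatic: ascents and descents are disjoint and
       equinumerous among [l.+1] indices. *)
    rewrite ascentsK // eqxx andbT; apply/esym; rewrite geq_uphalf_double -addnn -{1}card_ascents.
    rewrite -cardsUI (_ : _ :&: _ = finset.set0) ?cards0 ?addn0; last first.
      by apply/setP => j; rewrite !inE; case: (f j); rewrite /= ?andbF.
    by rewrite -[X in (_ <= X)%N]card_ord max_card.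
  rewrite (bigID (mem (ascents f))) /= -mulnA; congr (_ * _)%N.
    apply: eq_bigr => j; rewrite inE; by case: (f j); case: (f (ordS j)).
  rewrite (bigID (mem (descents f))) /=; congr (_ * _)%N; apply: eq_big => j;
    rewrite !inE; by case: (f j); case: (f (ordS j)).
rewrite (eq_bigr (fun=> \prod_j g0 j)%N); last first.
  move=> f; rewrite -eqn0Ngt => /eqP/descents0_constant ->.
  by apply: eq_bigr => j _; rewrite !ffunE eqxx.
rewrite sum_nat_const; congr (_ * _)%N.
transitivity #|imset (fun a => [ffun=> a] : {ffun 'I_l.+1 -> bool}) (mem {: bool})|.
  apply: eq_card => f; rewrite unfold_in /= -eqn0Ngt; apply/eqP/imsetP.
    by move/descents0_constant => ->; exists (f ord0).
  case=> a _ ->; apply/eqP; rewrite cards_eq0; apply/eqP/setP => j.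
  by rewrite !inE !ffunE; case: a.
by rewrite card_imset ?card_bool // => a b /ffunP/(_ ord0); rewrite !ffunE.
Qed.

End Alternation.

(** The trace is expanded over the parities [f j] at the starts of the arcs, and [sum_alternation]
    groups the terms by the arcs where the parity goes up or down. *)
Lemma coef_trace_arcs (l s : nat) (m : 'I_l.+1 -> nat) : (forall j, 0 < m j)%N ->
  (\tr (\prod_j (step_mx false ^+ (m j).-1 * step_mx true)))`_s
  = (facet_formula s m)%:Z.
Proof.
move=> m0; rewrite trace_prod_walk coef_sum.
under eq_bigr => f _ do rewrite coef_prod_ffun.
rewrite exchange_big /=.
have E (r : {ffun 'I_l.+1 -> 'I_s.+1}) :
    \sum_(f : {ffun 'I_l.+1 -> bool})
      \prod_j ((step_mx false ^+ (m j).-1 * step_mx true) (state (f j)) (state (f (ordS j))))`_(r j)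
  = (\sum_(f : {ffun 'I_l.+1 -> bool}) \prod_j
     (if f j == f (ordS j) then binz ((m j)%:Z - 1 - (r j)%:Z) (r j) else
      if f j then binz ((m j)%:Z - 2 - (r j)%:Z) (r j) else
      binz ((m j)%:Z - (r j)%:Z) (r j)))%N.
  rewrite -natz natr_sum; apply: eq_bigr => f _; rewrite natr_prod; apply: eq_bigr => j _.
  rewrite arc_mxE; have := m0 j; case: (m j) => // k _.
  by case: ifP => _; [|case: ifP => _]; rewrite coef_arc_poly natz; congr ((binz _ _)%:Z); lia.
under eq_bigr => r _ do rewrite E sum_alternation.
rewrite /facet_formula; move: (uphalf l) => h.
rewrite -[RHS]natz natrD natrM !natr_sum big_distrr -big_split /=.
by apply: eq_bigr => r _; rewrite -natz natrD natrM.
Qed.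

(** * Cyclic orders and arcs *)

Lemma traject_ordS n (i : 'I_n.+1) :
  traject (@ordS n.+1) i n.+1 = rot i (enum 'I_n.+1).
Proof.
have it k : val (iter k (@ordS n.+1) ord0) = (k %% n.+1)%N.
  by elim: k => [|k IH]; rewrite ?mod0n //= IH -addn1 modnDml addn1.
have iti : iter i (@ordS n.+1) ord0 = i.
  by apply: val_inj; rewrite it modn_small.
have itn : iter n.+1 (@ordS n.+1) ord0 = ord0.
  by apply: val_inj; rewrite it modnn.
have e0 : traject (@ordS n.+1) ord0 n.+1 = enum 'I_n.+1.
  apply: (@eq_from_nth _ ord0); first by rewrite size_traject size_enum_ord.
  move=> k; rewrite size_traject => kn; apply: val_inj.
  by rewrite nth_traject // it -[RHS]/(nat_of_ord _) nth_enum_ord // modn_small.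
have /(congr1 (drop i)) := trajectD (@ordS n.+1) i n.+1 ord0.
rewrite iti drop_size_cat ?size_traject // => <-.
rewrite addnC trajectD itn e0 drop_cat size_enum_ord ltn_ord /rot; congr (_ ++ _).
by rewrite -e0 take_traject // ltnW.
Qed.

Section CyclicArcs.
Variables (C : finType) (n : nat) (next : C -> C) (tau : 'I_n.+1 -> C).
Hypothesis tauP : cyclic_bijection next tau.

Lemma traject_next i : traject next (tau i) n.+1 = rot i [seq tau k | k <- enum 'I_n.+1].
Proof.
have traj k : forall j, traject next (tau j) k = map tau (traject (@ordS n.+1) j k).
  elim: k => // k IH j /=; rewrite -IH; congr (_ :: traject _ _ _).
  by have [_ ->] := tauP.
by rewrite traj traject_ordS map_rot.
Qed.

Lemma perm_traject_next x : perm_eq (traject next x n.+1) (enum C).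
Proof.
have [tau_bij _] := tauP; have [i ->] : exists i, x = tau i.
  by have [g _ gK] := tau_bij; exists (g x); rewrite gK.
rewrite traject_next perm_rot.
have tau_inj := bij_inj tau_bij.
apply: uniq_perm; rewrite ?(map_inj_uniq tau_inj) ?enum_uniq //.
move=> y; rewrite [RHS]mem_enum inE; apply/mapP.
by have [g _ gK] := tau_bij; exists (g y); rewrite ?mem_enum ?gK.
Qed.

Lemma card_cyclic : #|C| = n.+1.
Proof. by rewrite cardE -(perm_size (perm_traject_next (tau ord0))) size_traject. Qed.

Lemma next_inj : injective next.
Proof.
have [tau_bij tauS] := tauP; have [g gK Kg] := tau_bij.
move=> x y; rewrite -(Kg x) -(Kg y) !tauS => /(bij_inj tau_bij)/ordS_inj ->.
by [].
Qed.

Lemma iter_next_fix k x : iter k next x = x -> (n.+1 %| k)%N.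
Proof.
have [tau_bij tauS] := tauP; have [g gK Kg] := tau_bij.
have it i : iter k next (tau i) = tau (inord ((i + k) %% n.+1)).
  elim: k => [|k IH] /=; first by rewrite addn0 modn_small // inord_val.
  rewrite IH tauS; congr tau; apply: val_inj => /=.
  by rewrite !inordK ?ltn_mod // -addn1 modnDml addn1 addnS.
rewrite -(Kg x) it => /(bij_inj tau_bij)/(congr1 val)/=; rewrite inordK ?ltn_mod // => e.
have: (g x + k = g x + 0 %[mod n.+1])%N by rewrite e addn0 modn_small.
by move/eqP; rewrite eqn_modDl mod0n.
Qed.

Variables (l : nat) (D : {set C * C}) (arc : 'I_l.+1 -> {set C}).
Hypothesis DP : forall p, p \in D -> p.2 = next p.1.
Hypothesis card_D : #|D| = l.+1.
Hypothesis arcP : arc_numbering next D arc.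

Let isdiv c := (c, next c) \in D.

(** The numbering supplies a divider from each arc to its successor. A divider can neither enter nor
    leave an arc in its middle, so each arc is the stretch of the orbit between two such
    dividers. *)
Lemma arc_traject : exists first : 'I_l.+1 -> C, forall j,
  [/\ (0 < #|arc j|)%N, first (ordS j) = iter #|arc j| next (first j) &
      [seq isdiv c | c <- traject next (first j) #|arc j|]
      = rcons (nseq #|arc j|.-1 false) true].
Proof.
have [_ arcsE divE] := arcP.
have /choice[p pP] : forall j, exists p, [/\ p \in D, p.1 \in arc j & p.2 \in arc (ordS j)].
  by move=> j; have [p pD [p1 p2]] := divE j; exists p.
have key j : exists2 m : nat, #|arc j| = m.+1 &
    p j = (iter m next (p (ord_pred j)).2, iter m.+1 next (p (ord_pred j)).2) /\
    forall k, (k < m)%N -> isdiv (iter k next (p (ord_pred j)).2) = false.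
  have : arc j \in arcs next D by rewrite arcsE; apply/imsetP; exists j.
  rewrite inE => /maxsetp /existsP[x /existsP[m /andP[/eqP arcE srt]]].
  have mn : (m <= n.+1)%N by rewrite -card_cyclic -ltnS.
  have cm : #|arc j| = m.
    rewrite arcE cardsE; apply/eqP; rewrite -{2}(size_traject next x m).
    apply/eqP/card_uniqP; rewrite -(take_traject next x mn).
    by apply: take_uniq; rewrite (perm_uniq (perm_traject_next x)) enum_uniq.
  have nodiv k : (k.+1 < m)%N -> isdiv (iter k next x) = false.
    move=> km; have := sortedP x srt k; rewrite size_traject => /(_ km).
    by rewrite !nth_traject //; [move/negbTE|exact: ltnW].
  have pred_j : ordS (ord_pred j) = j by rewrite ord_predK.
  have [p1D _] := pP (ord_pred j); rewrite pred_j arcE inE => /trajectP[k km xk].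
  (* The entering divider ends at the first element of the arc; at any later position it would lie
     inside the run. *)
  have k0 : k = 0%N.
    case: k km xk => // k km xk; have := nodiv k km.
    move: xk; rewrite (DP p1D) iterS => /next_inj xk.
    by rewrite /isdiv -xk -(DP p1D) -surjective_pairing p1D.
  rewrite {}k0 /= in xk km.
  have [p2D + _] := pP j; rewrite arcE inE => /trajectP[k' km' xk'].
  case: m => [[|m] mC] /= in arcE srt mn cm nodiv km km' *; first by [].
  exists m; first by rewrite -arcE.
  rewrite xk; split; last by move=> i im; apply: nodiv.
  have k'm : k' = m.
    apply/eqP; move: km'; rewrite ltnS leq_eqVlt => /orP[//|k'm].
    by have := nodiv k' k'm; rewrite /isdiv -xk' -(DP p2D) -surjective_pairing p2D.
  by rewrite [LHS]surjective_pairing (DP p2D) xk' k'm.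
exists (fun j => (p (ord_pred j)).2) => j.
have [m cm [pj nodiv]] := key j; rewrite cm; split=> //.
  by rewrite ordSK pj.
apply: (@eq_from_nth _ false); first by rewrite size_map size_traject size_rcons size_nseq.
move=> k; rewrite size_map size_traject => km.
rewrite (nth_map (p (ord_pred j)).2) ?size_traject // nth_traject // nth_rcons size_nseq /=.
have [km'|mk] := ltnP k m; first by rewrite nodiv // nth_nseq km'.
have -> : k = m by lia.
have [pD _ _] := pP j.
by rewrite eqxx; move: pD; rewrite pj.
Qed.

(** From the first element of an arc, one turn around [C] runs through the arcs in order, which
    groups the factors; cyclic invariance of the trace moves the starting point. *)
Lemma trace_arcs : (forall j, 0 < #|arc j|)%N /\
  \tr (\prod_i step_mx ((tau i, next (tau i)) \in D)) =
  \tr (\prod_j (step_mx false ^+ #|arc j|.-1 * step_mx true)).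
Proof.
have [first firstP] := arc_traject; split; first by move=> j; have [] := firstP j.
pose o k : 'I_l.+1 := inord (k %% l.+1).
have oS k : o k.+1 = ordS (o k).
  by apply: val_inj; rewrite /= !inordK ?ltn_mod // -(addn1 (_ %% _)) modnDml addn1.
pose N k := \sum_(0 <= i < k) #|arc (o i)|.
have NS k : N k.+1 = (N k + #|arc (o k)|)%N by rewrite /N big_nat_recr.
have it k : iter (N k) next (first (o 0)) = first (o k).
  elim: k => [|k IH]; first by rewrite /N big_nil.
  by rewrite oS NS addnC iterD IH; have [_ ->] := firstP (o k).
have cnt k : count isdiv (traject next (first (o 0)) (N k)) = k.
  elim: k => [|k IH]; first by rewrite /N big_nil.
  rewrite NS trajectD count_cat IH it -(count_map isdiv id).
  have [_ _ ->] := firstP (o k).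
  rewrite -cats1 count_cat count_nseq /=; lia.
have prd k : \prod_(c <- traject next (first (o 0)) (N k)) step_mx (isdiv c) =
    \prod_(0 <= i < k) (step_mx false ^+ #|arc (o i)|.-1 * step_mx true).
  elim: k => [|k IH]; first by rewrite /N !big_nil.
  rewrite NS trajectD big_cat IH it big_nat_recr //=; congr (_ * _).
  rewrite -(big_map isdiv xpredT step_mx); have [_ _ ->] := firstP (o k).
  by rewrite -cats1 big_cat big_nseq big_seq1 iter_mulr_1.
(* One turn meets each of the [l.+1] dividers once. *)
have cntn q : count isdiv (traject next (first (o 0)) (q * n.+1)) = (q * l.+1)%N.
  have cnt1 x : count isdiv (traject next x n.+1) = l.+1.
    rewrite (permP (perm_traject_next x)) -card_D.
    have -> : D = imset (fun c => (c, next c)) (mem [pred c | isdiv c]).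
      apply/setP => p; apply/idP/imsetP => [pD|[c cD ->] //].
      exists p.1; last by rewrite -(DP pD) -surjective_pairing.
      by rewrite inE /isdiv -(DP pD) -surjective_pairing.
    rewrite card_imset; last by move=> u v [].
    by rewrite -sum1_count big_enum_cond /= -sum1_card; apply: eq_bigl.
  elim: q (first _) => // q IH x; by rewrite !mulSn trajectD count_cat IH cnt1.
have o0 : o l.+1 = o 0 by rewrite /o modnn mod0n.
(* The arcs close up after [q] turns around [C], which meet [q * l.+1] dividers. *)
have /dvdnP[q Nq] : (n.+1 %| N l.+1)%N by apply: (@iter_next_fix _ (first (o 0))); rewrite it o0.
have q1 : q = 1%N.
  by have := cnt l.+1; rewrite Nq cntn => /eqP; rewrite -{2}[l.+1]mul1n eqn_pmul2r // => /eqP.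
have := prd l.+1; rewrite Nq q1 mul1n => prd1.
have [tau_bij _] := tauP; have [g gK Kg] := tau_bij.
have := congr1 mxtrace prd1; rewrite -{1}(Kg (first (o 0))) traject_next trace_prod_rot big_map.
rewrite enumT -(locked_withE index_enum_key (Finite.enum _)) -/(index_enum _) big_mkord => ->.
congr mxtrace; apply: eq_bigr => j _; by rewrite /o modn_small // inord_val.
Qed.

End CyclicArcs.

(** * Gale sets and closed walks *)

Section GaleWalks.
Variable n : nat.
Variable D : pred 'I_n.+1.
Implicit Types (w : {ffun 'I_n.+1 -> bool}) (S : {set 'I_n.+1}).

(* [w i] is the parity of the run of elements of [S] that ends just before [i],
   corrected by the number of dividers met in that run. *)
Definition closed_walk w := [forall i, w i ==> (w (ordS i) == D i)].
Definition openings w := #|[set i | [&& ~~ D i, ~~ w i & w (ordS i)]]%SET|.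
Definition walk_support w : {set 'I_n.+1} := [set i | w i (+) w (ordS i) (+) D i]%SET.

(** A walk violating [closed_walk] contributes a zero factor, any other the power of ['X] with
    exponent [openings w]. *)
Lemma coef_trace_walks s :
  (\tr (\prod_i step_mx (D i)))`_s
  = #|[set w | closed_walk w && (openings w == s)]%SET|%:Z.
Proof.
rewrite trace_prod_walk coef_sum -sum1_card -natz natr_sum [RHS]big_mkcond.
apply: eq_bigr => w _; rewrite inE.
under eq_bigr => i _ do rewrite step_mxE.
rewrite big_split /= -expr_sum -natr_prod.
have -> : (\sum_i (~~ D i && ~~ w i && w (ordS i)))%N = openings w.
  rewrite /openings -sum1_card [RHS]big_mkcond; apply: eq_bigr => i _.
  by rewrite inE andbA; case: (_ && _).
have [ok|/forallPn[i wi]] := boolP (closed_walk w); last first.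
  by rewrite (bigD1 i) //= (negPf wi) mul0n mul0r coef0.
rewrite big1 ?mul1r; last by move=> i _; rewrite (forallP ok i).
by rewrite coefXn eq_sym; case: eqP.
Qed.

Lemma sum_ordS w : (\sum_i w (ordS i) = \sum_i w i)%N.
Proof. by rewrite [RHS](reindex_inj (@ordS_inj n.+1)). Qed.

(** Sum over i of the identity [i in S] + w (i + 1) = D i + 2 [opening at i] + w i, a finite check;
    the two sums of [w] cancel around the circle. *)
Lemma card_walk_support w : closed_walk w ->
  #|walk_support w| = (#|D| + (openings w).*2)%N.
Proof.
move=> /forallP ok; apply/eqP; rewrite -(eqn_add2r (\sum_i w i)) -{1}sum_ordS.
rewrite /openings -!sum1_card -muln2 big_distrl /=.
rewrite big_mkcond [X in (_ == X + _ + _)%N]big_mkcond [X in (_ == _ + X + _)%N]big_mkcond -!big_split /=.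
apply/eqP/eq_bigr => i _; rewrite !inE; have := ok i; rewrite unfold_in.
by case: (w i); case: (D i); case: (w (ordS i)).
Qed.

Lemma ordS_invariant (T : Type) (f : 'I_n.+1 -> T) :
  (forall i, f (ordS i) = f i) -> forall i, f i = f ord0.
Proof.
move=> fS; suff H k : (k <= n)%N -> f (inord k) = f ord0.
  by move=> i; rewrite -(H i) ?inord_val // -ltnS.
elim: k => [|k IH] kn; first by congr f; apply: val_inj; rewrite /= inordK.
rewrite -(IH (ltnW kn)) -[RHS]fS; congr f; apply: val_inj.
by rewrite /= !inordK ?modn_small //; lia.
Qed.

Variables (d : nat) (e : pred 'I_n.+1).
Hypothesis De : forall i, D i = e i (+) e (ordS i) (+) ((i == ord_max) && odd d).

(** For a node off [S], this is the sign of prod_(s in S) (t_i - t_s) q(t_i) up to the common factor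
    (-1)^|S|, when [e] marks the nodes where q is negative. *)
Definition gale_sign S (i : 'I_n.+1) := odd (cnt_below S i) (+) e i.

Definition gale S := (#|S| == d) &&
  [forall i, forall j, (i \notin S) && (j \notin S) ==> (gale_sign S i == gale_sign S j)].

(** In the closing gap the count falls from [d] back to 0, which the term [odd d] in [De]
    compensates. *)
Lemma gale_signS S i : #|S| = d ->
  gale_sign S (ordS i) = gale_sign S i (+) D i (+) (i \in S).
Proof.
move=> Sd; rewrite /gale_sign De; case: (eqVneq i ord_max) => [->|im] /=.
  rewrite modnn cnt_below0 /= -Sd -cnt_below_top (cnt_belowS S ord_max) oddD oddb.
  by case: (odd _); case: (e _); case: (e _); case: (_ \in _).
rewrite modn_small; last by rewrite ltn_neqAle ltn_ord andbT; apply: contraNneq im => - [] im; apply/eqP/val_inj.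
rewrite cnt_belowS oddD oddb.
by case: (odd _); case: (e _); case: (e _); case: (_ \in _).
Qed.

(** The bijection sends a walk to its support. Two walks with equal supports differ by a constant,
    which is zero at a node off the support; such a node exists as [d < n.+1]. *)
Lemma card_gale s : (#|D| + s.*2)%N = d -> (d < n.+1)%N ->
  #|[set S | gale S]%SET| = #|[set w | closed_walk w && (openings w == s)]%SET|.
Proof.
move=> ds dn; rewrite -(@card_in_imset _ _ walk_support).
  apply: eq_card => S; rewrite inE; apply/idP/imsetP => [/andP[/eqP Sd /forallP gS]|[w]].
    have [i0 i0S] : exists i, i \notin S.
      apply/existsP; rewrite -negb_forall; apply: contraTN dn => /forallP ST.
      rewrite -Sd -leqNgt -[X in (X <= _)%N]card_ord; apply: subset_leq_card.
      by apply/fintype.subsetP => i _; apply: ST.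
    (* Normalising at [i0] makes [w] vanish off [S]; this is where the Gale condition enters. *)
    pose w := [ffun i => gale_sign S i (+) gale_sign S i0].
    have wS : walk_support w = S.
      apply/setP => i; rewrite inE !ffunE gale_signS //.
      by case: (gale_sign S i); case: (gale_sign S i0); case: (D i); case: (i \in S).
    exists w; rewrite // inE.
    have wok : closed_walk w.
      apply/forallP => i; apply/implyP; rewrite !ffunE gale_signS //.
      have := forallP (gS i) i0; rewrite i0S andbT.
      case: (i \in S) => /=.
        by case: (gale_sign S i); case: (gale_sign S i0); case: (D i).
      by move/eqP => ->; rewrite addbb.
    rewrite wok /=; have := card_walk_support wok; rewrite wS Sd -ds.
    by move/addnI/double_inj => ->.
  rewrite inE => /andP[wok /eqP os] ->.
  have Sd : #|walk_support w| = d by rewrite card_walk_support // os.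
  rewrite /gale Sd eqxx /=.
  (* The Gale sign and [w] obey the same step rule, so their sum modulo 2 is constant around the
     circle. *)
  have cst := @ordS_invariant _ (fun i => gale_sign (walk_support w) i (+) w i).
  have {}cst i : gale_sign (walk_support w) i (+) w i = gale_sign (walk_support w) ord0 (+) w ord0.
    apply: cst => {}i; rewrite gale_signS // inE.
    by case: (gale_sign _ i); case: (w i); case: (w _); case: (D i).
  have w0 i : i \notin walk_support w -> w i = false.
    by rewrite inE; have := forallP wok i; case: (w i) => //= /eqP ->; case: (D i).
  apply/forallP => i; apply/forallP => j; apply/implyP => /andP[/w0 wi /w0 wj].
  by have := cst i; rewrite -(cst j) wi wj !addbF => ->.
move=> w w'; rewrite !inE => /andP[wok /eqP os] /andP[wok' _] ww'.
have Sd : #|walk_support w| = d by rewrite card_walk_support // os.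
have [i0 i0S] : exists i, i \notin walk_support w.
  apply/existsP; rewrite -negb_forall; apply: contraTN dn => /forallP ST.
  rewrite -Sd -leqNgt -[X in (X <= _)%N]card_ord; apply: subset_leq_card.
  by apply/fintype.subsetP => i _; apply: ST.
have w0 v i : closed_walk v -> i \notin walk_support v -> v i = false.
  by move=> vok; rewrite inE; have := forallP vok i; case: (v i) => //= /eqP ->; case: (D i).
have cst := @ordS_invariant _ (fun i => w i (+) w' i).
have {}cst i : w i (+) w' i = w ord0 (+) w' ord0.
  apply: cst => {}i; move/setP/(_ i): ww'; rewrite !inE.
  by case: (w i); case: (w' i); case: (w _); case: (w' _); case: (D i).
apply/ffunP => i; have := cst i; rewrite -(cst i0) (w0 w i0) // (w0 w' i0) -?ww' //.
by case: (w i); case: (w' i).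
Qed.

End GaleWalks.

(** * Sign changes and dividers *)

Section SignRuns.
Variables (R : realType) (d n : nat) (t : 'I_n.+1 -> R) (xi : 'rV[R]_d.+1).
Hypothesis t_mono : {homo t : i j / (i < j)%N >-> i < j}.
Hypothesis q_neq0 : forall i, Defs.qpoly xi (t i) != 0.

Definition negative_at (i : 'I_n.+1) := Defs.qpoly xi (t i) < 0.
Definition sign_change_set : {set 'I_n.+1} :=
  [set i : 'I_n.+1 | (i < n)%N && (negative_at i != negative_at (ordS i))]%SET.

Local Notation e := negative_at.
Local Notation CH := sign_change_set.
Local Notation c := (cnt_below sign_change_set).

Lemma eq_sg i j : (Num.sg (Defs.qpoly xi (t i)) == Num.sg (Defs.qpoly xi (t j))) = (e i == e j).
Proof.
by rewrite -!neqr0_sign // (inj_eq (@signr_inj R)).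
Qed.

Lemma ordS_lt (i : 'I_n.+1) : (i < n)%N -> ordS i = i.+1 :> nat.
Proof. by move=> ni; rewrite /= modn_small. Qed.

Lemma cnt_below_const (i j : nat) : (forall h : 'I_n.+1, h \in CH -> ~~ (i <= h < j)%N) ->
  (i <= j)%N -> c i = c j.
Proof.
move=> H ij; apply: eq_bigr => h hC; have := H h hC.
by have [ih|hi] := ltnP h i; rewrite ?(leq_trans ih ij) //= -leqNgt ltnNge => ->.
Qed.

Lemma cnt_below_mono (i j : nat) : (i <= j)%N -> (c i <= c j)%N.
Proof.
move=> ij; apply: leq_sum => h _.
by have [ih|//] := ltnP h i; rewrite (leq_trans ih ij).
Qed.

Lemma odd_cnt (j : 'I_n.+1) : odd (c j) = e j (+) e ord0.
Proof.
suff H k : (k <= n)%N -> odd (c k) = e (inord k) (+) e ord0.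
  by rewrite H ?inord_val // -ltnS.
elim: k => [|k IH] kn.
  by rewrite cnt_below0 (_ : inord 0 = ord0) ?addbb //; apply: val_inj; rewrite /= inordK.
have ik : (inord k : 'I_n.+1) = k :> nat by rewrite inordK //; lia.
have iS : inord k.+1 = ordS (inord k) :> 'I_n.+1.
  by apply: val_inj; rewrite /= ik inordK // modn_small.
rewrite -[in c _]ik cnt_belowS ik oddD oddb IH; last by lia.
rewrite inE ik kn iS /=.
by case: (e _); case: (e _); case: (e _).
Qed.

(* The maximal runs are the fibres of the number of sign changes met so far. *)
Definition run_class v : {set 'I_n.+1} := [set j : 'I_n.+1 | c j == v]%SET.

(** A sign change [h] between two members would put both [h] and [ordS h] into the run, with
    different signs. *)
Lemma sign_run_sub I i : sign_run t xi I -> i \in I -> I \subset run_class (c i).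
Proof.
move=> /forallP runI iI; apply/fintype.subsetP => j jI; rewrite inE.
have run a b : a \in I -> b \in I -> (e a = e b) /\ forall h : 'I_n.+1, (a <= h <= b)%N -> h \in I.
  move=> aI bI; have /implyP/(_ aI)/forallP/(_ b)/implyP/(_ bI)/andP[] := runI a.
  by rewrite eq_sg => /eqP -> /forallP h; split => // k kab; apply: (implyP (h k)).
have cc (a b : 'I_n.+1) : a \in I -> b \in I -> (a <= b)%N -> c a = c b.
  move=> aI bI ab; apply: cnt_below_const => // h; rewrite inE => /andP[hn].
  apply: contraNN => /andP[ah hb]; apply/eqP.
  have [_ btw] := run a b aI bI.
  have hI : h \in I by apply: btw; rewrite ah ltnW.
  have SI : ordS h \in I by apply: btw; rewrite ordS_lt // hb (leq_trans ah).
  by have [] := run h (ordS h) hI SI.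
by case: (leqP i j) => [ij|/ltnW ji]; [rewrite (cc i j)|rewrite (cc j i)].
Qed.

Lemma sign_run_class v : sign_run t xi (run_class v).
Proof.
apply/forallP => i; apply/implyP; rewrite inE => /eqP ci.
apply/forallP => j; apply/implyP; rewrite inE => /eqP cj.
apply/andP; split.
  have := odd_cnt i; have := odd_cnt j; rewrite eq_sg ci cj => ->.
  by case: (e i); case: (e j); case: (e _).
apply/forallP => h; apply/implyP => /andP[ih hj]; rewrite inE.
by have := cnt_below_mono ih; have := cnt_below_mono hj; lia.
Qed.

(** The count starts at 0 and grows by at most 1 per step. Hence the classes are nonempty, and
    distinct values give distinct classes. *)
Lemma cnt_surj v : (v <= #|CH|)%N -> exists i : 'I_n.+1, c i = v.
Proof.
suff H k : (k <= n)%N -> forall v, (v <= c k)%N -> exists i : 'I_n.+1, c i = v.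
  move=> vC; apply: (H n) => //; rewrite (leq_trans vC) // -cnt_below_top.
  by rewrite (cnt_belowS CH ord_max) inE ltnn addn0.
elim: k => [|k IH] kn {}v vk.
  by exists ord0; move: vk; rewrite !cnt_below0; lia.
have [/IH|] := leqP v (c k); first by apply; lia.
exists (Ordinal (kn : k.+1 < n.+1)%N).
have kl : (k < n.+1)%N by lia.
by move: vk; rewrite /= (cnt_belowS CH (Ordinal kl)) /=; case: (_ \in _); lia.
Qed.

Lemma signed_decompositionE :
  signed_decomposition t xi = [set run_class v | v : 'I_#|CH|.+1]%SET.
Proof.
have cle (i : 'I_n.+1) : (c i < #|CH|.+1)%N.
  by rewrite ltnS -cnt_below_top cnt_below_mono // ltnW.
apply/setP => I; rewrite inE; apply/idP/imsetP => [mI|[v _ ->]].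
  have [runI maxI] := maxsetP mI.
  have [I0|[i iI]] := set_0Vmem I.
    (* The empty run is not maximal: the class of 0 contains [ord0]. *)
    have := maxI _ (sign_run_class 0); rewrite I0 finset.sub0set => /(_ isT)/setP/(_ ord0).
    by rewrite !inE cnt_below0.
  by exists (Ordinal (cle i)) => //=; apply/esym/maxI; [exact: sign_run_class|exact: sign_run_sub].
apply/maxsetP; split; first exact: sign_run_class.
move=> J runJ sJ; apply/eqP; rewrite finset.eqEsubset sJ andbT.
have [i ci] := @cnt_surj v (ltn_ord v).
by rewrite -ci; apply: sign_run_sub => //; apply: (fintype.subsetP sJ); rewrite inE ci.
Qed.

Lemma card_signed_decomposition : #|signed_decomposition t xi| = #|CH|.+1.
Proof.
rewrite signed_decompositionE card_imset ?card_ord // => u v uv; apply: val_inj => /=.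
have [i ci] := @cnt_surj u (ltn_ord u).
by have /setP/(_ i) := uv; rewrite !inE ci eqxx => /esym/eqP.
Qed.

Lemma divider_at_ordS p : divider_at t xi p -> p.2 = ordS p.1.
Proof.
move=> H; apply: val_inj => /=; case/orP: H => [|/and3P[/eqP -> /eqP -> _]]; last by rewrite modnn.
case/existsP => I /andP[_ /existsP[J /and5P[_ _ _ _ /eqP e2]]].
by rewrite -e2 modn_small.
Qed.

Lemma divider_at_lt (i : 'I_n.+1) : (i < n)%N -> divider_at t xi (i, ordS i) = (i \in CH).
Proof.
move=> ni; rewrite /divider_at /= [(i == n :> nat)]ltn_eqF // orbF.
have cS : c (ordS i) = (c i + (i \in CH))%N by rewrite ordS_lt // cnt_belowS.
have clsE I j : I \in signed_decomposition t xi -> j \in I -> I = run_class (c j).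
  by rewrite signed_decompositionE => /imsetP[v _ ->]; rewrite inE => /eqP ->.
apply/existsP/idP => [[I /andP[ID /existsP[J /and5P[JD IJ iI iJ _]]]]|iC].
  apply: contraNT IJ => niC; rewrite (clsE I i) // (clsE J (ordS i)) //.
  by rewrite cS (negPf niC) addn0.
have cD (j : 'I_n.+1) : run_class (c j) \in signed_decomposition t xi.
  rewrite signed_decompositionE; apply/imsetP.
  have cj : (c j < #|CH|.+1)%N by rewrite ltnS -cnt_below_top cnt_below_mono // ltnW.
  by exists (Ordinal cj).
exists (run_class (c i)); rewrite cD /=; apply/existsP; exists (run_class (c (ordS i))).
rewrite cD !inE !eqxx modn_small ?eqxx ?andbT //=.
apply/eqP => /setP/(_ i); rewrite !inE eqxx cS iC; lia.
Qed.

Lemma divider_at_max : divider_at t xi (ord_max, ordS ord_max) = (odd d != odd #|CH|).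
Proof.
rewrite /divider_at /= modnn !eqxx /= /sign_changes card_signed_decomposition /=.
(* Consecutive runs do not meet at this gap, since [ordS ord_max] is 0 and not [n.+1]; only the
   closing clause remains. *)
rewrite orb_idl // => /existsP[I /andP[_ /existsP[J]]].
by rewrite !andbF.
Qed.

(** The number of sign changes has the parity of [e ord_max (+) e ord0], so the closing gap obeys
    the same rule as the others, corrected by [odd d]. This supplies the hypothesis [De]. *)
Lemma divider_at_parity (i : 'I_n.+1) : divider_at t xi (i, ordS i)
  = e i (+) e (ordS i) (+) ((i == ord_max) && odd d).
Proof.
have [->|im] := eqVneq i ord_max; last first.
  have ni : (i < n)%N by rewrite ltn_neqAle -ltnS ltn_ord andbT; apply: contraNneq im => im; apply/eqP/val_inj.
  by rewrite divider_at_lt // inE ni /= addbF; case: (e i); case: (e _).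
have -> : ordS ord_max = ord0 :> 'I_n.+1 by apply: val_inj; rewrite /= modnn.
rewrite /= (_ : ord0 = ordS ord_max); last by apply: val_inj; rewrite /= modnn.
rewrite divider_at_max -cnt_below_top (cnt_belowS CH ord_max) inE ltnn addn0 odd_cnt.
rewrite (_ : ordS ord_max = ord0); last by apply: val_inj; rewrite /= modnn.
by case: (odd d); case: (e _); case: (e _).
Qed.

Lemma qpolyE x : Defs.qpoly xi x = (rVpoly xi).[x].
Proof. by rewrite horner_poly; apply: eq_bigr => i _; rewrite valK. Qed.

(** Each sign change yields a root of q strictly inside its gap; these roots are distinct, and q is
    nonzero of degree at most [d]. *)
Lemma card_sign_change_set : (#|CH| <= d)%N.
Proof.
have /choice[z zP] : forall i, exists z, i \in CH ->
    [/\ t i < z, z < t (ordS i) & root (rVpoly xi) z].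
  move=> i; have [iC|_] := boolP (i \in CH); last by exists 0.
  move: (iC); rewrite inE => /andP[ni ei].
  have ti : t i < t (ordS i) by apply: t_mono; rewrite ordS_lt.
  have qi := q_neq0 i; have qS := q_neq0 (ordS i).
  have [z /andP[z1 z2] zr] : exists2 z, t i <= z <= t (ordS i) & root (rVpoly xi) z.
    move: ei qi qS; rewrite /negative_at !qpolyE => ei qi qS.
    have [q0|q0] := ltP (rVpoly xi).[t i] 0.
      apply: poly_ivt; rewrite ?(ltW ti) // (ltW q0) /= leNgt.
      by move: ei; rewrite q0; case: (_ < 0).
    (* [poly_ivt] asks for a nonpositive value on the left, hence the passage to the opposite
       polynomial. *)
    have [z zb] : exists2 z, t i <= z <= t (ordS i) & root (- rVpoly xi) z.
      apply: poly_ivt; rewrite ?(ltW ti) // !hornerN oppr_le0 q0 oppr_ge0 /=.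
      by move: ei; rewrite ltNge q0; case: ltP => // /ltW.
    by rewrite rootN; exists z.
  exists z => _; split=> //; rewrite lt_neqAle ?z1 ?z2 andbT.
    by apply: contraNneq qi => ->; rewrite qpolyE.
  by apply: contraNneq qS => <-; rewrite qpolyE.
have q0 : rVpoly xi != 0.
  by apply: contraNneq (q_neq0 ord0) => q0; rewrite qpolyE q0 horner0.
have := @max_poly_roots _ (rVpoly xi) [seq z i | i <- enum CH] q0.
rewrite size_map -cardE => H; rewrite -ltnS; apply: leq_trans (size_poly _ _); apply: H.
  by apply/allP => _ /mapP[i + ->]; rewrite mem_enum => /zP[].
rewrite map_inj_in_uniq ?enum_uniq // => i j; rewrite !mem_enum => iC jC.
have lt (a b : 'I_n.+1) : a \in CH -> b \in CH -> (a < b)%N -> z a < z b.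
  move=> aC bC ab; have [_ za _] := zP a aC; have [zb _ _] := zP b bC.
  apply: lt_trans za (le_lt_trans _ zb).
  have aS : ordS a = a.+1 :> nat by rewrite ordS_lt //; have := ltn_ord b; lia.
  have [<-//|sb] := eqVneq (ordS a) b; apply/ltW/t_mono.
  rewrite aS ltn_neqAle ab andbT -aS; apply: contraNneq sb => sb; apply/eqP/val_inj.
  by [].
case: (ltngtP i j) => [ij|ji|/val_inj//] zz.
  by have := lt i j iC jC ij; rewrite zz ltxx.
by have := lt j i jC iC ji; rewrite zz ltxx.
Qed.

(** The closing divider is present exactly when it is needed to correct the parity; the number of
    sign changes then differs from [d] and so is smaller. *)
Lemma card_dividers_at (D := [pred i | divider_at t xi (i, ordS i)]) :
  (#|D| <= d)%N /\ odd #|D| = odd d.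
Proof.
have -> : #|D| = (#|CH| + (odd d != odd #|CH|))%N.
  rewrite -divider_at_max -!sum1_card !(big_mkcond _ (fun=> 1%N)) /=.
  rewrite !big_ord_recr /= !inE ltnn addn0 /=; congr (_ + _)%N.
  apply: eq_bigr => i _; rewrite unfold_in /= divider_at_lt //= ltn_ord.
have := card_sign_change_set; move: #|CH| => k kd; rewrite oddD oddb.
split; last by case: (odd d); case: (odd k).
case: (eqVneq (odd d) (odd k)) => [_|dk]; first by rewrite addn0.
by rewrite addn1 ltn_neqAle kd andbT; apply: contraNneq dk => ->.
Qed.

End SignRuns.

(** * Faces of a point configuration *)

Local Open Scope classical_set_scope.

Section PointConfiguration.
Variables (R : realType) (V : vectType R) (n : nat) (v : 'I_n -> V).
Variable xi : 'Hom(V, R^o).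
Hypothesis xi_v : forall i, xi (v i) = 1.
Implicit Types (S : {set 'I_n}) (F : set V) (g : 'Hom(V, R^o)).

Local Notation P := (conv_hull (range v)).

Lemma homZ g a x : g (a *: x) = a * g x.
Proof. exact: linearZ. Qed.

Lemma conv_hull_range x : P x -> exists c : 'I_n -> R,
  [/\ forall i, 0 <= c i, \sum_i c i = 1 & x = \sum_i c i *: v i].
Proof.
pose Q : set V := [set x | exists c : 'I_n -> R,
  [/\ forall i, 0 <= c i, \sum_i c i = 1 & x = \sum_i c i *: v i]].
apply: (@smallest_sub _ _ (range v) Q).
  move=> y z l; rewrite !inE => -[a [a0 a1 ->]] [b [b0 b1 ->]].
  exists (fun i => l%:num * a i + (1 - l%:num) * b i); split.
  - move=> i; by apply: addr_ge0; apply: mulr_ge0.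
  - by rewrite big_split -!mulr_sumr a1 b1 !mulr1 /= addrC subrK.
  - rewrite /conv /= !scaler_sumr -big_split; apply: eq_bigr => i _ /=.
    by rewrite [RHS]scalerDl !scalerA.
move=> _ [i _ <-]; exists (fun j => (j == i)%:R); split => [j||].
- by case: (j == i).
- by rewrite (bigD1 i) //= eqxx big1 ?addr0 // => j /negPf ->.
- by rewrite (bigD1 i) //= eqxx scale1r big1 ?addr0 // => j /negPf ->; rewrite scale0r.
Qed.

Lemma conv_hull_vertex i : P (v i).
Proof. by apply: sub_gen_smallest; exists i. Qed.

Lemma conv_hull_ge0 g x : (forall i, 0 <= g (v i)) -> P x -> 0 <= g x.
Proof.
move=> g0 /conv_hull_range[c [c0 _ ->]]; rewrite linear_sum sumr_ge0 // => i _.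
by rewrite /= homZ mulr_ge0.
Qed.

Lemma conv_hull_xi x : P x -> xi x = 1.
Proof.
move=> /conv_hull_range[c [_ c1 ->]]; rewrite linear_sum -c1; apply: eq_bigr => i _.
by rewrite /= homZ xi_v mulr1.
Qed.

(** Nonnegative terms with sum zero all vanish, so a point where [g] is positive gets weight
    zero. *)
Lemma zero_face_combination g x : (forall i, 0 <= g (v i)) -> P x -> g x = 0 ->
  exists c : 'I_n -> R,
    [/\ forall i, g (v i) != 0 -> c i = 0, \sum_i c i = 1 & x = \sum_i c i *: v i].
Proof.
move=> g0 /conv_hull_range[c [c0 c1 ->]]; rewrite linear_sum => gx.
exists c; split=> // i gi.
have /allP : all (fun i => (i \in 'I_n) ==> (g (c i *: v i) == 0)) (index_enum 'I_n).
  rewrite -psumr_eq0; first by apply/eqP.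
  by move=> j _; rewrite /= homZ mulr_ge0.
move=> /(_ i (mem_index_enum i)) /=; rewrite /= homZ mulf_eq0 (negPf gi) orbF.
by move/eqP.
Qed.

Definition vspan S : {vspace V} := <<[seq v i | i <- enum S]>>%VS.

Lemma dim_lker_xi (W : {vspace V}) p : p \in W -> xi p = 1 ->
  (\dim (W :&: lker xi)).+1 = \dim W.
Proof.
move=> pW xp; rewrite -(limg_ker_dim xi W) -addn1; congr (_ + _)%N.
apply/eqP; rewrite eqn_leq; apply/andP; split; last first.
  apply: leq_trans (dimvS (subvf _)) _; by rewrite dimvf.
rewrite lt0n dimv_eq0; apply/negP => /eqP H.
have := memv_img xi pW; rewrite H memv0 xp.
by rewrite (negPf (@oner_neq0 R)).
Qed.

Section SpannedSet.
Variables (S : {set 'I_n}) (F : set V).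
Hypothesis FS : forall i, i \in S -> F (v i).
Hypothesis SF : forall x, F x -> exists c : 'I_n -> R,
    [/\ forall i, i \notin S -> c i = 0, \sum_i c i = 1 & x = \sum_i c i *: v i].

(** Applying [xi] to a combination of the [v i] gives the sum of its coefficients, so the affine
    condition is the equation [xi x = 1]. *)
Lemma affine_hull_span : affine_hull F = [set x | x \in vspan S /\ xi x = 1].
Proof.
have memF x : F x -> x \in vspan S /\ xi x = 1.
  move=> /SF[c [cS c1 ->]]; split; last first.
    by rewrite linear_sum -c1; apply: eq_bigr => i _; rewrite /= homZ xi_v mulr1.
  apply: rpred_sum => i _; have [iS|/cS ->] := boolP (i \in S); last by rewrite scale0r mem0v.
  by apply/rpredZ/memv_span/mapP; exists i; rewrite ?mem_enum.
apply/seteqP; split=> [x [m [a [y [Fy a1 ->]]]]|x [xW x1]].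
  split; first by apply: rpred_sum => i _; apply: rpredZ; have [] := memF _ (Fy i).
  rewrite linear_sum -a1; apply: eq_bigr => i _; rewrite /= homZ.
  by have [_ ->] := memF _ (Fy i); rewrite mulr1.
pose X := in_tuple [seq v i | i <- enum S].
have xE := coord_span (xW : x \in <<X>>%VS).
have Xi (i : 'I_(size [seq v i | i <- enum S])) : exists2 j, j \in S & X`_i = v j.
  have /mapP[j] : X`_i \in [seq v i | i <- enum S] by rewrite mem_nth.
  by rewrite mem_enum => jS ->; exists j.
exists (size [seq v i | i <- enum S]), (fun i => coord X i x), (fun i => X`_i); split=> //.
  by move=> i; have [j jS ->] := Xi i; apply: FS.
move: x1; rewrite {1}xE linear_sum => <-; apply: eq_bigr => i _.
by rewrite /= homZ; have [j jS ->] := Xi i; rewrite xi_v mulr1.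
Qed.

(* The vertices lie in the hyperplane [xi = 1], which misses the origin, so the
   affine dimension is one less than the linear rank. *)
Lemma has_dim_span k : has_dim F k <-> \dim (vspan S) = k.+1.
Proof.
rewrite /has_dim affine_hull_span; split=> [[p [U [/seteqP[sWU sUW] <-]]]|dW].
  have [pW xp] : p \in vspan S /\ xi p = 1.
    by apply: (sUW p); exists 0; rewrite ?addr0 //= mem0v.
  rewrite -(dim_lker_xi pW xp); congr (\dim _).+1; apply/vspaceP => u.
  rewrite memv_cap memv_ker; apply/andP/idP => [[uW /eqP xu]|uU].
    have [|u' u'U /addrI <- //] := sWU (p + u).
    by rewrite /= linearD /= xp xu addr0 rpredD.
  have [] := sUW (p + u); first by exists u.
  move=> puW; rewrite linearD /= xp => /eqP; rewrite addrC -subr_eq0 addrK => xu.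
  by split=> //; rewrite -(addKr p u) rpredD ?rpredN.
have [S0|[i iS]] := set_0Vmem S.
  by move: dW; rewrite /vspan S0 (_ : enum _ = [::]) ?enum_set0 //= span_nil dimv0.
have vW : v i \in vspan S by apply/memv_span/mapP; exists i; rewrite ?mem_enum.
exists (v i), (vspan S :&: lker xi)%VS; split; last first.
  by apply: succn_inj; rewrite (dim_lker_xi vW (xi_v i)).
apply/seteqP; split=> x /=.
  move=> [xW x1]; exists (x - v i); last by rewrite addrC subrK.
  by rewrite /= memv_cap memv_ker linearB /= x1 xi_v subrr eqxx rpredB.
move=> [u]; rewrite memv_cap memv_ker => /andP[uW /eqP xu] <-.
by rewrite linearD /= xi_v xu addr0 rpredD.
Qed.

End SpannedSet.

End PointConfiguration.

(** * Facets of a Veronese polytope *)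

Section VeroneseFacets.
Variables (R : realType) (d n : nat) (t : 'I_n.+1 -> R) (xi : 'rV[R]_d.+1).
Hypothesis d_le_n : (d <= n)%N.
Hypothesis d_gt0 : (0 < d)%N.
Hypothesis t_mono : {homo t : i j / (i < j)%N >-> i < j}.
Hypothesis q_neq0 : forall i, Defs.qpoly xi (t i) != 0.
Implicit Types (S : {set 'I_n.+1}) (c : 'rV[R]_d.+1).

Lemma t_inj : injective t.
Proof.
move=> i j; case: (ltngtP i j) => [ij|ij|/val_inj//] tij.
  by have := t_mono ij; rewrite tij ltxx.
by have := t_mono ij; rewrite tij ltxx.
Qed.

Definition pairing c (y : 'rV[R]_d.+1) : R^o := \sum_i c 0 i * y 0 i.

Lemma pairing_is_linear c : linear (pairing c).
Proof.
move=> a x y; rewrite /pairing scaler_sumr -big_split; apply: eq_bigr => i _ /=.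
by rewrite !mxE mulrDr scalerAr.
Qed.

HB.instance Definition _ c :=
  GRing.isLinear.Build R 'rV[R]_d.+1 R^o _ (pairing c) (pairing_is_linear c).

Definition form c : 'Hom('rV[R]_d.+1, R^o) := linfun (pairing c).

Lemma formE c y : form c y = \sum_i c 0 i * y 0 i.
Proof. by rewrite lfunE. Qed.

Lemma linear_form (a : {linear 'rV[R]_d.+1 -> R^o}) : a =1 form (\row_i a (delta_mx 0 i)).
Proof.
move=> y; rewrite formE [in LHS](row_sum_delta y) linear_sum; apply: eq_bigr => i _.
by rewrite linearZ mxE mulrC.
Qed.

Lemma form_lin a c c' y : form (a *: c + c') y = a * form c y + form c' y.
Proof.
rewrite !formE mulr_sumr -big_split; apply: eq_bigr => i _ /=.
by rewrite !mxE mulrDl mulrA.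
Qed.

Lemma formZ a c y : form (a *: c) y = a * form c y.
Proof. by rewrite !formE mulr_sumr; apply: eq_bigr => i _; rewrite !mxE mulrA. Qed.

Lemma form0 y : form 0 y = 0.
Proof. by rewrite formE big1 // => i _; rewrite mxE mul0r. Qed.

Definition vertex (i : 'I_n.+1) := (Defs.qpoly xi (t i))^-1 *: veronese d (t i).

Lemma form_vertex c i : form c (vertex i) = Defs.qpoly c (t i) / Defs.qpoly xi (t i).
Proof.
rewrite homZ mulrC formE; congr (_ / _).
by apply: eq_bigr => j _; rewrite mxE.
Qed.

Lemma form_xi_vertex i : form xi (vertex i) = 1.
Proof. by rewrite form_vertex divff. Qed.

Definition node_poly (s : seq 'I_n.+1) : {poly R} := \prod_(i <- s) ('X - (t i)%:P).
(** This row holds all coefficients of the node polynomial only when [size s <= d]. *)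
Definition node_form s : 'rV[R]_d.+1 := poly_rV (node_poly s).

Lemma qpoly_node_form (s : seq 'I_n.+1) x : (size s <= d)%N ->
  Defs.qpoly (node_form s) x = \prod_(i <- s) (x - t i).
Proof.
move=> sd; rewrite qpolyE poly_rV_K; last by rewrite size_prod_XsubC.
by rewrite horner_prod; apply: eq_bigr => i _; rewrite !hornerE.
Qed.

Lemma form_node_eq0 (s : seq 'I_n.+1) i : (size s <= d)%N ->
  (form (node_form s) (vertex i) == 0) = (i \in s).
Proof.
move=> sd; rewrite form_vertex mulf_eq0 invr_eq0 (negPf (q_neq0 i)) orbF.
rewrite qpoly_node_form // prodf_seq_eq0; apply/hasP/idP => [[j js]|iS].
  by rewrite /= subr_eq0 => /eqP/t_inj ->.
by exists i => //=; rewrite subrr.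
Qed.

(* The node polynomial of [s] vanishes on the span of the vertices of [s] only. *)
Lemma free_vertices (s : seq 'I_n.+1) : uniq s -> (size s <= d.+1)%N ->
  free [seq vertex i | i <- s].
Proof.
elim: s => [|i s IH] /=; first by rewrite nil_free.
move=> /andP[iS us] sd; rewrite free_cons IH // ?andbT; last exact: ltnW.
apply/negP => iW.
have : (<<[seq vertex j | j <- s]>> <= lker (form (node_form s)))%VS.
  by apply/span_subvP => _ /mapP[j js ->]; rewrite memv_ker form_node_eq0.
by move=> /subvP/(_ _ iW); rewrite memv_ker form_node_eq0 // (negPf iS).
Qed.

Lemma dim_vspan S : \dim (vspan vertex S) = minn #|S| d.+1.
Proof.
have [Sd|dS] := leqP #|S| d.+1.
  have /eqP -> : free [seq vertex i | i <- enum S].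
    by apply: free_vertices; rewrite ?enum_uniq -?cardE.
  by rewrite size_map -cardE.
apply/eqP; rewrite eqn_leq; apply/andP; split.
  by apply: leq_trans (dimvS (subvf _)) _; rewrite dimvf /dim /= mul1n.
have sz : size [seq vertex i | i <- take d.+1 (enum S)] = d.+1.
  by rewrite size_map size_takel // -cardE ltnW.
have /eqP fr : free [seq vertex i | i <- take d.+1 (enum S)].
  apply: free_vertices; first exact/take_uniq/enum_uniq.
  by rewrite size_takel // -cardE ltnW.
rewrite -{1}sz -fr; apply/dimvS/sub_span => _ /mapP[i iS ->].
by apply: map_f; apply: mem_take iS.
Qed.

Local Notation P := (veronese_polytope t xi).

Definition zeros c : {set 'I_n.+1} := [set i | form c (vertex i) == 0]%SET.

Definition zero_face c : set 'rV[R]_d.+1 := P `&` [set x | form c x = 0].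

(** All vertices lie on [form xi x = 1], so an inequality [a x <= b] becomes the homogeneous one b
    xi - a >= 0. *)
Lemma face_form F : face P F <->
  exists c, (forall i, 0 <= form c (vertex i)) /\ F = zero_face c.
Proof.
split=> [[a [b [ab ->]]]|[c [c0 ->]]].
  pose c := (-1) *: (\row_i a (delta_mx 0 i)) + b *: xi.
  have cE x : form xi x = 1 -> form c x = b - a x.
    by move=> x1; rewrite form_lin formZ x1 -linear_form mulr1 mulN1r addrC.
  exists c; split=> [i|].
    rewrite cE ?form_xi_vertex // subr_ge0; apply: ab.
    exact: (@conv_hull_vertex _ _ _ vertex i).
  apply/seteqP; split=> x [Px /= xb]; split=> //=;
    have x1 := conv_hull_xi form_xi_vertex Px; first by rewrite cE // xb subrr.
  by apply/eqP; rewrite eq_sym -subr_eq0 -cE // xb.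
exists ((-1) \*: form c), 0; split=> [x Px|].
  by rewrite /= scaleN1r oppr_le0; apply: conv_hull_ge0 Px.
apply/seteqP; split=> x [Px /= xb]; split=> //=; first by rewrite xb scaler0.
by apply/eqP; rewrite -oppr_eq0 -scaleN1r xb.
Qed.

Lemma has_dim_zero_face c k : (forall i, 0 <= form c (vertex i)) ->
  has_dim (zero_face c) k <-> minn #|zeros c| d.+1 = k.+1.
Proof.
move=> c0; rewrite -dim_vspan; apply: has_dim_span; first exact: form_xi_vertex.
  by move=> i; rewrite inE => /eqP ci; split=> //; apply: conv_hull_vertex.
move=> x [Px xc]; have [a [a0 a1 xE]] := zero_face_combination c0 Px xc.
by exists a; split=> // i; rewrite inE => /a0.
Qed.

Lemma has_dim_polytope k : has_dim P k <-> d = k.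
Proof.
(* The whole polytope is the face cut out by the zero form, so the same dimension formula applies to
   it. *)
have -> : P = zero_face 0.
  apply/seteqP; split=> x; last by case.
  by move=> Px; split=> //; exact: form0.
rewrite has_dim_zero_face => [|i]; last by rewrite form0.
have -> : #|zeros 0| = n.+1.
  by rewrite -[RHS]card_ord; apply: eq_card => i; rewrite !inE form0 eqxx.
have -> : minn n.+1 d.+1 = d.+1 by apply/minn_idPr.
by split=> [[]|->].
Qed.

(** Dimension d - 1 means [minn #|zeros c| d.+1 = d], that is, exactly [d] vertices on the face. *)
Lemma facet_form F : facet P F <->
  exists c, [/\ forall i, 0 <= form c (vertex i), #|zeros c| = d & F = zero_face c].
Proof.
rewrite /facet face_form; split=> [[[c [c0 ->]] [k [/has_dim_polytope dk]]]|[c [c0 cd ->]]].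
  rewrite has_dim_zero_face // => H; exists c; split=> //.
  by move: H; rewrite dk /minn; case: ltnP; lia.
split; first by exists c.
exists d.-1; rewrite has_dim_polytope has_dim_zero_face // cd.
by have := minn_idPl (leqnSn d); lia.
Qed.

(** Each node of [S] above [i] contributes a negative factor, and there are [#|S| - cnt_below S i]
    of them. *)
Lemma sgr_node_form S i : (#|S| <= d)%N -> i \notin S ->
  Num.sg (form (node_form (enum S)) (vertex i)) =
  (-1) ^+ (odd #|S| (+) gale_sign (@negative_at R d n t xi) S i).
Proof.
move=> Sd iS; rewrite form_vertex sgrM sgrV qpoly_node_form -?cardE //.
rewrite -[X in _ * X]neqr0_sign // -/(negative_at t xi i) /gale_sign addbA signr_addb.
congr (_ * _); rewrite big_enum /= (big_morph _ (@sgrM R) (@sgr1 R)).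
have cS : #|S| = (cnt_below S i + \sum_(j in S) ~~ (j < i))%N.
  by rewrite -big_split -sum1_card; apply: eq_bigr => j _ /=; case: (j < i)%N.
rewrite cS oddD addbAC addbb addFb signr_odd expr_sum; apply: eq_bigr => j jS.
have ij : i != j by apply: contraNneq iS => ->.
have [ji|ij'] := ltnP j i; first by rewrite gtr0_sg // subr_gt0 t_mono.
by rewrite ltr0_sg // subr_lt0 t_mono // ltn_neqAle ij' andbT.
Qed.

Local Notation gale := (gale d (@negative_at R d n t xi)).

Definition gale_face S := zero_face (node_form (enum S)).

Lemma zeros_node_form S : (#|S| <= d)%N -> zeros (node_form (enum S)) = S.
Proof. by move=> Sd; apply/setP => i; rewrite inE form_node_eq0 -?cardE // mem_enum. Qed.

Lemma zero_faceZ a c : a != 0 -> zero_face (a *: c) = zero_face c.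
Proof.
move=> a0; apply/seteqP; split=> x [Px /= xc]; split=> //=; last by rewrite formZ xc mulr0.
by apply/eqP; move/eqP: xc; rewrite formZ mulf_eq0 (negPf a0).
Qed.

Lemma notin_card S : #|S| = d -> exists i, i \notin S.
Proof.
move=> Sd; apply/existsP; rewrite -negb_forall; apply/negP => /forallP ST.
have : (#|'I_n.+1| <= #|S|)%N by apply/subset_leq_card/fintype.subsetP => i _; apply: ST.
by rewrite card_ord Sd ltnNge d_le_n.
Qed.

(** A node off the zero set shows that the polynomial of [c] is nonzero; having degree at most [d]
    and [d] known roots, it is a multiple of the node polynomial. *)
Lemma zeros_proportional c : #|zeros c| = d ->
  exists2 k, k != 0 & c = k *: node_form (enum (zeros c)).
Proof.
move=> cd; have [i ic] := notin_card cd.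
have p0 : rVpoly c != 0.
  apply: contraNneq ic => c0.
  by rewrite inE form_vertex qpolyE c0 horner0 mul0r.
pose rs := [seq t j | j <- enum (zeros c)].
have rs_size : size rs = d by rewrite size_map -cardE.
have rs_uniq : uniq rs by rewrite map_inj_uniq ?enum_uniq //; exact: t_inj.
have rs_root : all (root (rVpoly c)) rs.
  apply/allP => _ /mapP[j + ->]; rewrite mem_enum inE form_vertex mulf_eq0 invr_eq0.
  by rewrite (negPf (q_neq0 j)) orbF qpolyE.
have sz : size (rVpoly c) = (size rs).+1.
  apply/eqP; rewrite eqn_leq max_poly_roots // andbT rs_size; exact: size_poly.
have pE := all_roots_prod_XsubC sz rs_root; rewrite uniq_rootsE in pE.
exists (lead_coef (rVpoly c)); first by rewrite lead_coef_eq0.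
by rewrite -linearZ -[LHS]rVpolyK {1}(pE rs_uniq) /node_poly /rs big_map.
Qed.

Lemma facets_gale_face : facets P = gale_face @` [set S | gale S].
Proof.
apply/seteqP; split=> [F /facet_form[c [c0 cd ->]]|_ [S /= /andP[/eqP Sd /forallP gS] <-]].
  have [k k0 cE] := zeros_proportional cd.
  exists (zeros c); last by rewrite /gale_face {2}cE zero_faceZ.
  rewrite /= /gale cd eqxx; apply/forallP => i; apply/forallP => j.
  apply/implyP => /andP[iS jS].
  (* The form [c] is positive at the vertices off its zero set, so the sign of [k] fixes the Gale
     sign there. *)
  have sg1 h : h \notin zeros c ->
      Num.sg k * (-1) ^+ (odd d (+) gale_sign (@negative_at R d n t xi) (zeros c) h) = 1.
    move=> hS; rewrite -{1}cd -sgr_node_form ?cd // -sgrM -formZ -cE gtr0_sg //.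
    by rewrite lt_neqAle c0 andbT eq_sym; move: hS; rewrite inE.
  have sgk : Num.sg k != 0 by rewrite sgr_eq0.
  have /(mulfI sgk)/signr_inj/addbI -> // := etrans (sg1 i iS) (esym (sg1 j jS)).
apply/facet_form; have [i0 i0S] := notin_card Sd.
pose c := node_form (enum S).
have zc : zeros c = S by rewrite zeros_node_form // Sd.
have sg0 : Num.sg (form c (vertex i0)) != 0.
  by rewrite sgr_eq0; move: i0S; rewrite -{1}zc inE.
(* The node form has a single sign at the vertices off [S]; multiplying by that sign makes it
   nonnegative on all vertices. *)
exists (Num.sg (form c (vertex i0)) *: c); split.
- move=> i; rewrite formZ; have [iS|iS] := boolP (i \in S).
    by move: iS; rewrite -{1}zc inE => /eqP ->; rewrite mulr0.
  rewrite (_ : Num.sg _ = Num.sg (form c (vertex i))); last first.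
    rewrite /c !sgr_node_form ?Sd //; congr (_ ^+ (_ (+) _)).
    by have /forallP/(_ i) := gS i0; rewrite i0S iS => /eqP.
  by rewrite -normrEsg normr_ge0.
- rewrite -[RHS]Sd -zc; apply: eq_card => i; rewrite !inE formZ mulf_eq0.
  by rewrite (negPf sg0).
- by rewrite zero_faceZ.
Qed.

Lemma gale_face_inj S S' : gale S -> gale S' -> gale_face S = gale_face S' -> S = S'.
Proof.
move=> /andP[/eqP Sd _] /andP[/eqP Sd' _] FF.
have mem (U : {set 'I_n.+1}) i : #|U| = d -> gale_face U (vertex i) <-> i \in U.
  move=> Ud; rewrite -[in i \in U](zeros_node_form (eq_leq Ud)) inE.
  split=> [[_ /eqP//]|/eqP ui]; split=> //.
  exact: (@conv_hull_vertex _ _ _ vertex i).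
apply/setP => i; apply/idP/idP => iS.
  by apply/(mem _ _ Sd'); rewrite -FF; apply/(mem _ _ Sd).
by apply/(mem _ _ Sd); rewrite FF; apply/(mem _ _ Sd').
Qed.

Lemma card_facets : (facets P #= `I_#|[set S | gale S]%SET|)%card.
Proof.
rewrite facets_gale_face; apply: card_eq_trans (inj_card_eq _) _.
  by move=> S S'; rewrite !inE /=; exact: gale_face_inj.
set A := [set S | gale S]%SET.
rewrite (_ : [set S | gale S] = range (@enum_val _ (mem A))).
  apply: card_eq_trans (inj_card_eq (in2W enum_val_inj)) _.
  by rewrite card_eq_sym card_II.
apply/seteqP; split=> [S gS|_ [i _ <-]].
  have SA : S \in A by rewrite inE.
  by exists (enum_rank_in SA S); rewrite // enum_rankK_in.
by have := enum_valP i; rewrite inE.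
Qed.

End VeroneseFacets.

(** * Nonvanishing of q in the interior of a chamber *)

Section Chamber.
Variables (R : realType) (d n : nat) (t : 'I_n -> R).

Lemma continuous_qpoly x : continuous (fun c : 'rV[R]_d.+1 => Defs.qpoly c x).
Proof.
move=> c; rewrite /Defs.qpoly; apply: cvg_big => [||i _]; [exact: add_continuous|exact: nbhs_filter|].
have ci := @coord_continuous R 1 d.+1 0 i c.
have cx : (fun=> x ^+ i) @ nbhs c --> x ^+ i by exact: cvg_cst.
exact: (cvgM ci cx).
Qed.

Lemma qpoly_lin a (c c' : 'rV[R]_d.+1) x :
  Defs.qpoly (c + a *: c') x = Defs.qpoly c x + a * Defs.qpoly c' x.
Proof.
rewrite /Defs.qpoly mulr_sumr -big_split; apply: eq_bigr => i _ /=.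
by rewrite !mxE mulrDl mulrA.
Qed.

(* [q] keeps a weak sign at [t i] on a chamber, whereas a small multiple of the
   constant polynomial moves a zero value to either side. *)
Lemma chamber_interior_neq0 (sigma : set 'rV[R]_d.+1) xi i :
  chamber t sigma -> interior sigma xi -> Defs.qpoly xi (t i) != 0.
Proof.
move=> [xi0 H0 ->] xi_int; apply/negP => /eqP q0.
pose f := fun c : 'rV[R]_d.+1 => Defs.qpoly c (t i).
pose K := connected_component (hyperplane_complement t) xi0.
have fc : continuous f by exact: continuous_qpoly.
have Kxi0 : K xi0 by exact: connected_component_refl.
have fK c : K c -> f c != 0 by move=> /connected_component_sub/(_ i).
have /connected_intervalP itv : connected (f @` K).
  apply: connected_continuous_connected; first exact: component_connected.
  exact: continuous_subspaceT.
have sgK c : K c -> 0 <= Num.sg (f xi0) * f c.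
  move=> Kc; have fc0 := fK _ Kc; have f0 := fK _ Kxi0.
  have im c' : K c' -> (f @` K) (f c') by move=> ?; exists c'.
  have n0 : ~ (f @` K) 0 by move=> [c' /fK] /eqP.
  case: (ltrgt0P (f xi0)) f0 => // f0 _.
    rewrite gtr0_sg // mul1r leNgt; apply/negP => fcn; apply: n0.
    by apply: itv (im _ Kc) (im _ Kxi0) _ _; rewrite !ltW.
  rewrite ltr0_sg // mulN1r oppr_ge0 leNgt; apply/negP => fcn; apply: n0.
  by apply: itv (im _ Kxi0) (im _ Kc) _ _; rewrite !ltW.
have sub : closure K `<=` [set c | 0 <= Num.sg (f xi0) * f c].
  have cl : closed [set c | 0 <= Num.sg (f xi0) * f c].
    apply: (@preimage_closed _ _ (fun c => Num.sg (f xi0) * f c) [set x | 0 <= x]).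
      move=> c _; have cs : (fun=> Num.sg (f xi0)) @ nbhs c --> Num.sg (f xi0).
        exact: cvg_cst.
      exact: (cvgM cs (fc c)).
    exact: closed_ge.
  by rewrite [X in _ `<=` X]((closure_id _).1 cl); apply: closureS => c /sgK.
pose e : 'rV[R]_d.+1 := delta_mx 0 0.
have fe : f e = 1.
  rewrite /f /Defs.qpoly (bigD1 ord0) //= mxE !eqxx expr0 mulr1 big1 ?addr0 //.
  by move=> j j0; rewrite mxE (negPf j0) mul0r.
pose g := fun h : R => xi + h *: e.
have gc : g h @[h --> (0 : R)] --> g 0.
  apply: cvgD; first exact: cvg_cst.
  by apply: cvgZ; [exact: cvg_id|exact: cvg_cst].
have : nbhs (g 0) (closure K) by rewrite /g scale0r addr0.
move=> /gc/nbhs_ballP[eps /= eps0 Heps].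
have fg h : f (g h) = h by rewrite /f /g qpoly_lin q0 add0r -/(f e) fe mulr1.
have s1 : `|Num.sg (f xi0)| = 1 by rewrite normr_sg fK.
(* Adding this multiple of the constant polynomial gives [f] the sign that is excluded on the
   closure. *)
have in_ball : ball (0 : R) eps (- Num.sg (f xi0) * (eps / 2)).
  rewrite /ball /= sub0r normrN normrM normrN s1 mul1r gtr0_norm ?divr_gt0 //.
  by rewrite ltr_pdivrMr // ltr_pMr // ltr1n.
have := sub _ (Heps _ in_ball); rewrite /= fg mulrA mulrN -expr2 sqr_sg fK //.
by rewrite mulN1r oppr_ge0 leNgt divr_gt0.
Qed.

End Chamber.

(** * Transport of dividers to the cyclic order, and the facet count *)

Lemma dividers_next n d (R : realType) (t : 'I_n.+1 -> R) (xi : 'rV[R]_d.+1)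
    (C : finType) (next : C -> C) (tau : 'I_n.+1 -> C) :
  cyclic_bijection next tau ->
  [/\ forall p, p \in dividers tau t xi -> p.2 = next p.1,
      forall i, ((tau i, next (tau i)) \in dividers tau t xi) = divider_at t xi (i, ordS i)
    & #|dividers tau t xi| = #|[pred i | divider_at t xi (i, ordS i)]|].
Proof.
move=> [tau_bij tauS]; have tau_inj := bij_inj tau_bij.
split.
- by move=> p /imsetP[p' ]; rewrite inE => /divider_at_ordS e ->; rewrite tauS /= e.
- move=> i; apply/imsetP/idP => [[p]|di].
    rewrite inE tauS => dp [/tau_inj ip /tau_inj jp].
    by move: dp; rewrite [p]surjective_pairing -ip -jp.
  by exists (i, ordS i); rewrite ?inE // tauS.
have -> : dividers tau t xi =
    imset (fun i => (tau i, tau (ordS i))) (mem [pred i | divider_at t xi (i, ordS i)]).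
  apply/setP => p; apply/imsetP/imsetP => [[p']|[i]].
    rewrite inE => dp ->; exists p'.1; first by rewrite inE -(divider_at_ordS dp) -surjective_pairing.
    by rewrite -(divider_at_ordS dp).
  by rewrite inE => di ->; exists (i, ordS i); rewrite ?inE.
by rewrite card_imset // => i j [/tau_inj].
Qed.

Local Open Scope card_scope.

Theorem theorem3p23 (R : realType) (d n : nat) (t : 'I_n -> R)
    (sigma : set 'rV[R]_d.+1) (xi : 'rV[R]_d.+1)
    (C : finType) (next : C -> C) (tau : 'I_n -> C)
    (l : nat) (arc : 'I_l -> {set C}) :
  (1 <= d)%N -> (d.+1 <= n)%N ->
  {homo t : i j / (i < j)%N >-> i < j} ->
  chamber t sigma -> interior sigma xi ->
  cyclic_bijection next tau ->
  l = #|dividers tau t xi| -> (1 <= l)%N ->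
  arc_numbering next (dividers tau t xi) arc ->
  facets (veronese_polytope t xi)
    #= `I_(facet_formula (d - l)./2 (fun j => #|arc j|)).
Proof.
case: n t tau => // n t tau; case: l arc => // l arc.
move=> d0 dn t_mono sigma_ch xi_int tauP lE _ arcP.
have q0 i : Defs.qpoly xi (t i) != 0 by exact: chamber_interior_neq0 sigma_ch xi_int.
have [DP DE Dcard] := dividers_next t xi tauP.
have [l_le l_odd] := card_dividers_at t_mono q0.
rewrite -Dcard -lE in l_le l_odd.
have [arc0 trE] := trace_arcs tauP DP (esym lE) arcP.
set s := (d - l.+1)./2.
(* The number of dividers is at most [d] and has its parity, so the halving is exact. *)
have ds : (#|[pred i | divider_at t xi (i, ordS i)]| + s.*2)%N = d.
  by rewrite -Dcard -lE /s; move: l_le l_odd; lia.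
suff -> : facet_formula s (fun j => #|arc j|)
    = #|[set S | gale d (@negative_at R d n t xi) S]%SET|.
  exact: card_facets.
(* Both numbers are the coefficient of ['X^s] in the same trace, evaluated arc by arc and gap by
   gap. *)
apply/eqP; rewrite -eqz_nat -(coef_trace_arcs s arc0) -trE; apply/eqP.
under eq_bigr => i _ do rewrite DE.
rewrite (coef_trace_walks (fun i => divider_at t xi (i, ordS i))); congr (_%:Z).
by rewrite (card_gale (divider_at_parity q0) ds).
Qed.
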